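(* Let $k\ge3$ and let $F_k$ be the free group on $\gamma_1,\dots,\gamma_k$. Let $$\varDelta^1_{2i}=(\tau_{12i}-\tau_{1i2})(\tau_{\bar1\bar2\bar i}-\tau_{\bar1\bar i\bar2})-(\tau_{1\bar2\bar i}-\tau_{1\bar i\bar2})(\tau_{\bar12i}-\tau_{\bar1i2}),$$ $$\operatorname{crit}(\mathcal T)=\bigcup_{i=2}^k\{\tau_{1i\bar1\bar i}=\tau_{i1\bar i\bar1}\}\cup\bigcup_{i=3}^k\{\varDelta^1_{2i}=0\}\subset\mathcal R^*(F_k,\mathrm{SL}_3(\mathbb C)).$$ Then the volume form on $\mathcal R^*(F_k,\mathrm{SL}_3(\mathbb C))\setminus\operatorname{crit}(\mathcal T)$ is $$\Omega_{F_k}=\pm\,\omega_{12}\wedge\nu_1\wedge\nu_2\wedge\nu_{12}\wedge\bigwedge_{i=3}^k\frac{\omega_{1i}\wedge\nu_i\wedge\nu_{1i}\wedge\nu_{2i}}{3\,\varDelta^1_{2i}},$$ where $$\nu_i=\sqrt{-3}\,d\tau_i\wedge d\tau_{\bar i},\qquad \nu_{\ell i}=\sqrt{-3}\,d\tau_{\ell i}\wedge d\tau_{\bar\ell\,\bar i},\qquad \omega_{1i}=\frac{d\tau_{1\bar i}\wedge d\tau_{\bar1i}}{\tau_{1i\bar1\bar i}-\tau_{i1\bar i\bar1}} .$$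
   Context: Notation: $\tau_{i_1\cdots i_l}$ is the function $[\rho]\mapsto\operatorname{tr}\rho(\gamma_{i_1}\cdots\gamma_{i_l})$, with the convention $\gamma_{\bar i}=\gamma_i^{-1}$. A representation $\rho\colon F_k\to\mathrm{SL}_3(\mathbb C)$ is good if its image is contained in no proper parabolic subgroup (i.e. it is irreducible) and its centralizer is the center of $\mathrm{SL}_3(\mathbb C)$. $\mathcal R^*(F_k,\mathrm{SL}_3(\mathbb C))$ is the set of conjugacy classes of good representations, a complex manifold of dimension $8k-8$ with $T_{[\rho]}\mathcal R^*(F_k,\mathrm{SL}_3(\mathbb C))\cong H^1(F_k;\operatorname{Ad}\rho)$ (the path $\rho_s$ corresponds to the class of the cocycle $\gamma\mapsto\frac{d}{ds}\rho_s(\gamma)\rho(\gamma)^{-1}|_{s=0}$). Volume form $\Omega_{F_k}$ (Reidemeister torsion, defined up to sign): let $\mathcal B(X,Y)=-\operatorname{tr}(XY)$ on $\mathfrak g=\mathfrak{sl}_3(\mathbb C)$. Let $C^0=\mathfrak g$, $C^1=\mathfrak g^k$, $\delta(X)=(\operatorname{Ad}_{\rho(\gamma_i)}X-X)_{i=1}^k$, so that $H^1(F_k;\operatorname{Ad}\rho)=C^1/\operatorname{Im}\delta$. Let $\mathbf c^0$ be a $\mathcal B$-orthonormal basis of $\mathfrak g$ and $\mathbf c^1$ the corresponding basis of $\mathfrak g^k$. For a basis $\mathbf h$ of $H^1(F_k;\operatorname{Ad}\rho)$ with representatives $\widetilde{\mathbf h}\subset C^1$, $\Omega_{F_k}(\wedge\mathbf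 h)=\pm[\delta\mathbf c^0\sqcup\widetilde{\mathbf h}:\mathbf c^1]$, where $[\mathbf a:\mathbf b]$ is the determinant of the matrix expressing $\mathbf a$ in terms of $\mathbf b$ and $\wedge\mathbf h$ is the exterior product of the elements of $\mathbf h$. *)

(* Defs.v *)
From HB Require Import structures.
From mathcomp Require Import all_boot all_order all_algebra.
From mathcomp Require Import complex.
From mathcomp Require Import all_classical all_reals all_analysis.
Import Order.TTheory GRing.Theory Num.Theory.
Import numFieldNormedType.Exports.

Set Implicit Arguments.
Unset Strict Implicit.
Unset Printing Implicit Defensive.

Local Open Scope ring_scope.

(* The complex numbers, over an arbitrary model [R] of the real numbers; the
   topology used by [derivable] and [derive1] is that of the modulus. *)
Definition Cplx (R : realType) : numClosedFieldType := R[i].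

Section FreeGroupCharacterVariety.
Variables (R : realType) (k : nat).
Local Notation C := (Cplx R).

(* A letter [(i, false)] is gamma_i and [(i, true)] is gamma_i^-1, so every
   element of F_k is represented by a word. *)
Definition word : Type := seq ('I_k * bool).
Definition gam (i : 'I_k) : 'I_k * bool := (i, false).
Definition bar (i : 'I_k) : 'I_k * bool := (i, true).

(* A homomorphism from F_k is given by the images of the free generators. *)
Definition gens : Type := 'I_k -> 'M[C]_3.

Definition is_SL3_rep (rho : gens) : Prop := forall i, \det (rho i) = 1.

Definition ev (rho : gens) (w : word) : 'M[C]_3 :=
  \prod_(l <- w) (if l.2 then (rho l.1)^-1 else rho l.1).

Definition tau (w : word) (rho : gens) : C := \tr (ev rho w).

Definition irreducible_rep (rho : gens) : Prop :=
  forall U : {vspace 'cV[C]_3},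
    (forall w v, v \in U -> ev rho w *m v \in U) -> U = 0%VS \/ U = fullv.

Definition SL3_center (g : 'M[C]_3) : Prop :=
  \det g = 1 /\ forall h : 'M[C]_3, \det h = 1 -> g * h = h * g.

Definition SL3_centralizer (rho : gens) (g : 'M[C]_3) : Prop :=
  \det g = 1 /\ forall w, g * ev rho w = ev rho w * g.

(* The points of R^*(F_k, SL_3(C)) are the conjugacy classes of these. *)
Definition good_rep (rho : gens) : Prop :=
  [/\ is_SL3_rep rho, irreducible_rep rho &
      forall g, SL3_centralizer rho g <-> SL3_center g].

(* Differentiable curves s |-> rho_s of representations with rho_0 = rho; a
   tangent vector at [rho] is represented by such a curve. *)
Definition curve : Type := C -> gens.

Definition curve_at (rho : gens) (p : curve) : Prop :=
  [/\ forall s, is_SL3_rep (p s), forall i, p 0 i = rho i &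
      forall i, derivable (fun s => p s i) 0 1].

(* The cocycle gamma_i |-> d/ds rho_s(gamma_i) rho(gamma_i)^-1 at s = 0; its
   class in H^1(F_k; Ad rho) is the tangent vector of the curve. *)
Definition velocity (rho : gens) (p : curve) : {ffun 'I_k -> 'M[C]_3} :=
  [ffun i => derive1 (fun s => p s i * (rho i)^-1 : 'M[C]_3) 0].

(* Values of differentials on the tangent vector of a curve. *)
Definition differential (f : gens -> C) (p : curve) : C := derive1 (fun s => f (p s)) 0.

Definition sl3 : {vspace 'M[C]_3} := lker (linfun (@mxtrace C 3 : 'M[C]_3 -> C^o)).

Definition calB (X Y : 'M[C]_3) : C := - \tr (X * Y).

Definition B_orthonormal_basis (c0 : 8.-tuple 'M[C]_3) : Prop :=
  basis_of sl3 c0 /\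
  forall a b : 'I_8, calB (tnth c0 a) (tnth c0 b) = (a == b)%:R.

Definition single (i : 'I_k) (X : 'M[C]_3) : {ffun 'I_k -> 'M[C]_3} :=
  [ffun j => if j == i then X else 0].

Definition basis1 (c0 : 8.-tuple 'M[C]_3) :
    (k * 8).-tuple {ffun 'I_k -> 'M[C]_3} :=
  allpairs_tuple single (ord_tuple k) c0.

Definition coboundary (rho : gens) (X : 'M[C]_3) : {ffun 'I_k -> 'M[C]_3} :=
  [ffun i => rho i * X * (rho i)^-1 - X].

(* [a : b]; the family [a] is meant to have [m] elements. *)
Definition basis_det (V : vectType C) (m : nat) (a : seq V) (b : m.-tuple V) : C :=
  \det (\matrix_(i < m, j < m) coord b j a`_i).

(* Omega_{F_k} on the family of classes in H^1(F_k; Ad rho) represented by [h],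
   for a fixed choice of c^0, which determines it up to sign. *)
Definition Omega (c0 : 8.-tuple 'M[C]_3) (rho : gens)
    (h : seq {ffun 'I_k -> 'M[C]_3}) : C :=
  basis_det ([seq coboundary rho X | X <- c0] ++ h) (basis1 c0).

(* The form [coef] * a_1 /\ ... /\ a_n, where a_1, ..., a_n are the [factors]. *)
Record dform := DForm { coef : C; factors : seq (curve -> C) }.

Definition wedge (a b : dform) : dform :=
  DForm (coef a * coef b) (factors a ++ factors b).

Definition one_form : dform := DForm 1 [::].

Definition scale_form (c : C) (a : dform) : dform :=
  DForm (c * coef a) (factors a).

Definition dtau (w : word) : dform := DForm 1 [:: differential (tau w)].

(* (a_1 /\ ... /\ a_n)(v_1, ..., v_n) = det (a_i (v_j)); here [n] is meant to be
   the degree of [a]. *)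
Definition eval_form (n : nat) (a : dform) (v : 'I_n -> curve) : C :=
  coef a * \det (\matrix_(i < n, j < n) (nth (fun=> 0) (factors a) i) (v j)).

Definition nu1 (i : 'I_k) : dform :=
  scale_form (sqrtC (-3)) (wedge (dtau [:: gam i]) (dtau [:: bar i])).

Definition nu2 (l i : 'I_k) : dform :=
  scale_form (sqrtC (-3))
    (wedge (dtau [:: gam l; gam i]) (dtau [:: bar l; bar i])).

Definition tau_comm (l i : 'I_k) (rho : gens) : C :=
  tau [:: gam l; gam i; bar l; bar i] rho
  - tau [:: gam i; gam l; bar i; bar l] rho.

Definition omega_form (l i : 'I_k) (rho : gens) : dform :=
  scale_form (tau_comm l i rho)^-1
    (wedge (dtau [:: gam l; bar i]) (dtau [:: bar l; gam i])).

(* [Delta l m i] is varDelta^l_{m i}. *)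
Definition Delta (l m i : 'I_k) (rho : gens) : C :=
  (tau [:: gam l; gam m; gam i] rho - tau [:: gam l; gam i; gam m] rho)
  * (tau [:: bar l; bar m; bar i] rho - tau [:: bar l; bar i; bar m] rho)
  - (tau [:: gam l; bar m; bar i] rho - tau [:: gam l; bar i; bar m] rho)
    * (tau [:: bar l; gam m; gam i] rho - tau [:: bar l; gam i; gam m] rho).

(* Below [g1] and [g2] are the indices of gamma_1 and gamma_2; as ordinals count
   from 0, i = 2, ..., k is [0 < i] and i = 3, ..., k is [1 < i]. *)
Definition crit (g1 g2 : 'I_k) (rho : gens) : Prop :=
  (exists2 i : 'I_k, (0 < i)%N &
     tau [:: gam g1; gam i; bar g1; bar i] rho
     = tau [:: gam i; gam g1; bar i; bar g1] rho) \/
  (exists2 i : 'I_k, (1 < i)%N & Delta g1 g2 i rho = 0).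

Definition trace_volume_form (g1 g2 : 'I_k) (rho : gens) : dform :=
  wedge (wedge (wedge (wedge (omega_form g1 g2 rho) (nu1 g1)) (nu1 g2)) (nu2 g1 g2))
    (\big[wedge/one_form]_(i < k | (1 < i)%N)
       scale_form (3 * Delta g1 g2 i rho)^-1
         (wedge (wedge (wedge (omega_form g1 i rho) (nu1 i)) (nu2 g1 i)) (nu2 g2 i))).

End FreeGroupCharacterVariety.

(* Main.v *)
Require Import Defs.
From mathcomp Require Import all_boot all_order all_fingroup all_algebra.
From mathcomp Require Import spectral complex ring zify.
From mathcomp Require Import all_classical all_reals all_analysis.
Import Order.TTheory GRing.Theory Num.Theory numFieldNormedType.Exports.

Set Implicit Arguments.
Unset Strict Implicit.
Unset Printing Implicit Defensive.

Local Open Scope ring_scope.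

(* Evaluate everything on cocycles u in sl_3^k. The differentials of the trace
   functions kill coboundaries; so, for any eight auxiliary functionals phi,
     det [delta c0; u] * det (phi, dtau) = det (phi (delta c0)) * det (dtau (u)).
   Let phi see only the first two components of u. Then (phi, dtau) is block
   triangular, with an 8 x 8 block for each i >= 3 and one 16 x 16 block, which
   splits in two. With A = rho_i and B = rho_1, such a block is up to a constant
   the 9 x 9 determinant of
     1, -BA^-1, AB^-1, A, -A^-1, AB, -B^-1A^-1, X1, X2
   in the entries. The first seven matrices are trace-orthogonal to
   Y = ABA^-1 - B and Y' = AB^-1A^-1 - B^-1, so this is a multiple of the 2 x 2
   determinant of the pairings of Y, Y' with X1, X2; the factor is the commutator
   trace difference. For X1 = A rho_2 and X2 = - rho_2^-1 A^-1 the pairing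
   determinant is Delta. Likewise det (phi (delta c0)) is computed from the
   operators Ad - 1. Both are polynomial identities, so A (resp. B) may be taken
   diagonal. The factors sqrt(-3) come from the determinant of (1, c0), whose
   square is -3 because tr 1 = 3 and c0 is orthonormal for -tr(XY). *)

(** * Determinants *)

Section Determinants.
Variable F : comNzRingType.
Implicit Types f g : nat -> nat -> F.

(* Entries are indexed by [nat], so that block decompositions need no casts. *)
Definition detn n f : F := \det (\matrix_(i < n, j < n) f i j).

Lemma eq_detn n f g :
  (forall i j, (i < n)%N -> (j < n)%N -> f i j = g i j) -> detn n f = detn n g.
Proof. by move=> fg; congr (\det _); apply/matrixP => i j; rewrite !mxE fg. Qed.

Lemma detn_tr n f : detn n (fun i j => f j i) = detn n f.
Proof. by rewrite /detn -det_tr; congr (\det _); apply/matrixP => i j; rewrite !mxE. Qed.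

Lemma detn_mul n f g :
  detn n f * detn n g = detn n (fun i j => \sum_(l < n) f i l * g l j).
Proof.
rewrite /detn -det_mulmx; congr (\det _); apply/matrixP => i j; rewrite !mxE.
by apply: eq_bigr => l _; rewrite !mxE.
Qed.

Lemma detn_lower n m f :
  (forall i j, (i < n)%N -> (j < m)%N -> f i (n + j)%N = 0) ->
  detn (n + m) f = detn n f * detn m (fun i j => f (n + i)%N (n + j)%N).
Proof.
move=> f0; rewrite /detn -[X in \det X = _]submxK (_ : ursubmx _ = 0).
  rewrite det_lblock; congr (_ * _); congr (\det _); apply/matrixP => i j;
  by rewrite !mxE.
by apply/matrixP => i j; rewrite !mxE /= f0.
Qed.

Lemma detn_upper n m f :
  (forall i j, (i < m)%N -> (j < n)%N -> f (n + i)%N j = 0) ->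
  detn (n + m) f = detn n f * detn m (fun i j => f (n + i)%N (n + j)%N).
Proof.
move=> f0; rewrite -detn_tr detn_lower => [|i j im jn]; last exact: f0.
by rewrite !(detn_tr _ f, detn_tr _ (fun i j => f (n + i)%N (n + j)%N)).
Qed.

Lemma detn_scale_row n (c : nat -> F) f :
  detn n (fun i j => c i * f i j) = (\prod_(i < n) c i) * detn n f.
Proof.
rewrite /detn -(big_mkord xpredT) /=.
rewrite (_ : \matrix_(i < n, j < n) _ =
  diag_mx (\row_(i < n) c i) *m \matrix_(i < n, j < n) f i j).
  rewrite det_mulmx det_diag; congr (_ * _); rewrite big_mkord.
  by apply: eq_bigr => i _; rewrite mxE.
by apply/matrixP => i j; rewrite mul_diag_mx !mxE.
Qed.

Lemma detn_scale_col n (c : nat -> F) f :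
  detn n (fun i j => f i j * c j) = (\prod_(i < n) c i) * detn n f.
Proof.
rewrite -detn_tr -[in RHS]detn_tr -detn_scale_row.
by apply: eq_detn => i j _ _; rewrite mulrC.
Qed.

Lemma detn_col_perm n (s : 'S_n) f :
  detn n (fun i j => f i (if insub j is Some j' then s j' : nat else j))
  = (-1) ^+ s * detn n f.
Proof.
rewrite /detn (_ : \matrix_(i < n, j < n) f i _ =
   col_perm s (\matrix_(i < n, j < n) f i j)).
  by rewrite col_permE det_mulmx det_perm mulrC odd_permV.
by apply/matrixP => i j; rewrite !mxE valK.
Qed.

(** The sign comes from [s] alone and is produced before [f]. Such uniformity is kept throughout,
    since the final sign must not depend on the representation. *)
Lemma detn_col_reindex n (s : seq nat) : perm_eq s (iota 0 n) ->
  exists e : bool, forall f,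
    detn n (fun i j => f i (nth 0%N s j)) = (-1) ^+ e * detn n f.
Proof.
move=> ps; have sz : size s = n by rewrite (perm_size ps) size_iota.
have sn (j : 'I_n) : (nth 0%N s j < n)%N.
  have : nth 0%N s j \in s by apply: mem_nth; rewrite sz.
  by rewrite (perm_mem ps) mem_iota.
have si : injective (fun j : 'I_n => Ordinal (sn j)).
  move=> i j [] /eqP; rewrite nth_uniq ?sz// ?(perm_uniq ps) ?iota_uniq//.
  by move=> /eqP/val_inj.
exists (odd_perm (perm si)) => f; rewrite -detn_col_perm.
by apply: eq_detn => i j _ jn; rewrite insubT permE.
Qed.

Lemma detn_row_reindex n (s : seq nat) : perm_eq s (iota 0 n) ->
  exists e : bool, forall f,
    detn n (fun i j => f (nth 0%N s i) j) = (-1) ^+ e * detn n f.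
Proof.
move=> /detn_col_reindex[e se]; exists e => f.
by rewrite -[in RHS]detn_tr -se detn_tr.
Qed.

Lemma detn_reindex n (s : seq nat) f : perm_eq s (iota 0 n) ->
  detn n (fun i j => f (nth 0%N s i) (nth 0%N s j)) = detn n f.
Proof.
move=> /detn_col_reindex[e se]; rewrite (se (fun i j => f (nth 0%N s i) j)).
by rewrite -detn_tr (se (fun i j => f j i)) detn_tr signrMK.
Qed.

Lemma detnS n f : detn n.+1 f =
  \sum_(j < n.+1) f 0%N j * ((-1) ^+ j * detn n (fun i' j' => f i'.+1 (bump j j'))).
Proof.
rewrite /detn (expand_det_row _ ord0); apply: eq_bigr => j _; rewrite !mxE /cofactor.
congr (_ * (_ * \det _)); apply/matrixP => i' j'; rewrite !mxE //=.
Qed.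

Lemma detn0 f : detn 0 f = 1.
Proof. by rewrite /detn det_mx00. Qed.

Lemma detn2 f : detn 2 f = f 0%N 0%N * f 1%N 1%N - f 0%N 1%N * f 1%N 0%N.
Proof.
by rewrite !(detnS, big_ord_recl, big_ord0, detn0) /= /bump /=; ring.
Qed.

Lemma detn3 f : detn 3 f =
  f 0%N 0%N * (f 1%N 1%N * f 2%N 2%N - f 1%N 2%N * f 2%N 1%N)
  - f 0%N 1%N * (f 1%N 0%N * f 2%N 2%N - f 1%N 2%N * f 2%N 0%N)
  + f 0%N 2%N * (f 1%N 0%N * f 2%N 1%N - f 1%N 1%N * f 2%N 0%N).
Proof.
by rewrite !(detnS, big_ord_recl, big_ord0, detn0) /= /bump /=; ring.
Qed.
End Determinants.

(** * Identities between 9 x 9 determinants *)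

Section Matrices3.
Variable F : comNzRingType.
Implicit Types (A B X Y : 'M[F]_3) (s : seq 'M[F]_3).

(** Indices in [nat] let literal positions compute, so that identities between 3 x 3 matrices can be
    passed to [ring] entry by entry. *)
Definition ent A (i j : nat) : F := A (inord i) (inord j).

Lemma entE A (i j : 'I_3) : A i j = ent A i j.
Proof. by rewrite /ent !inord_val. Qed.

Lemma ent_mul A B i j : ent (A * B) i j =
  ent A i 0 * ent B 0 j + ent A i 1 * ent B 1 j + ent A i 2 * ent B 2 j.
Proof.
rewrite {1}/ent mxE !big_ord_recr big_ord0 /= add0r /ent.
by do 5?[congr (_ + _)]; congr (A _ _ * B _ _); apply: val_inj; rewrite /= inordK.
Qed.

Lemma ent_add A B i j : ent (A + B) i j = ent A i j + ent B i j.
Proof. exact: mxE. Qed.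

Lemma ent_opp A i j : ent (- A) i j = - ent A i j.
Proof. exact: mxE. Qed.

Lemma ent_scale c A i j : ent (c *: A) i j = c * ent A i j.
Proof. exact: mxE. Qed.

Lemma ent_one i j : (i < 3)%N -> (j < 3)%N -> ent 1 i j = (i == j)%:R.
Proof. by move=> i3 j3; rewrite /ent mxE -val_eqE /= !inordK. Qed.

Lemma ent_trace A : \tr A = ent A 0 0 + ent A 1 1 + ent A 2 2.
Proof.
rewrite /mxtrace !big_ord_recr big_ord0 /= add0r /ent.
by do 5?[congr (_ + _)]; congr (A _ _); apply: val_inj; rewrite /= inordK.
Qed.

Lemma tr_mulC X Y : \tr (X * Y) = \tr (Y * X).
Proof. exact: mxtrace_mulC. Qed.

Lemma ent_det A : \det A = detn 3 (ent A).
Proof.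
by congr (\det _); apply/matrixP => i j; rewrite !mxE entE.
Qed.

Lemma ent_adj A i j : (i < 3)%N -> (j < 3)%N -> ent (\adj A) i j =
  (-1) ^+ (j + i) * (ent A (bump j 0) (bump i 0) * ent A (bump j 1) (bump i 1)
   - ent A (bump j 0) (bump i 1) * ent A (bump j 1) (bump i 0)).
Proof.
move=> i3 j3; rewrite {1}/ent mxE /cofactor !inordK//; congr (_ * _).
rewrite -[RHS](detn2 (fun k l => ent A (bump j k) (bump i l))).
congr (\det _); apply/matrixP => k l; rewrite !mxE entE /=.
by rewrite !inordK.
Qed.

Lemma matrix3P A B :
  (forall i j, (i < 3)%N -> (j < 3)%N -> ent A i j = ent B i j) -> A = B.
Proof. by move=> AB; apply/matrixP => i j; rewrite !entE AB. Qed.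

Definition pos9 : seq (nat * nat) := [seq (i, j) | i <- iota 0 3, j <- iota 0 3].

Definition coord9 A c : F := ent A (nth (0%N, 0%N) pos9 c).1 (nth (0%N, 0%N) pos9 c).2.

Definition det9 s := detn 9 (fun r c => coord9 (nth 0 s r) c).

(* Adjugates stand for inverses, so that the identities are polynomial in
   arbitrary matrices. *)
Definition comm_trace A B :=
  \tr (B * A * (\adj B * \adj A)) - \tr (A * B * (\adj A * \adj B)).

Definition twist A B := A * B * \adj A - \det A *: B.

Definition pairing A B X1 X2 : F :=
  \tr (twist A B * X1) * \tr (twist A (\adj B) * X2)
  - \tr (twist A B * X2) * \tr (twist A (\adj B) * X1).

Definition diagonal3 A := forall i j, (i < 3)%N -> (j < 3)%N -> i != j -> ent A i j = 0.

Lemma ent_diagonal A : diagonal3 A ->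
  (ent A 0 1 = 0) * (ent A 0 2 = 0) * (ent A 1 0 = 0) *
  (ent A 1 2 = 0) * (ent A 2 0 = 0) * (ent A 2 1 = 0).
Proof. by move=> dA; rewrite !dA. Qed.

Lemma diagonal3_adj A : diagonal3 A -> diagonal3 (\adj A).
Proof.
move=> dA i j i3 j3; have aE := ent_diagonal dA; rewrite ent_adj//.
by case: i i3 => [|[|[|]]]// _; case: j j3 => [|[|[|]]]// _ _ //=;
  rewrite /bump /= ?aE; ring.
Qed.

Lemma detn4 (f : nat -> nat -> F) : detn 4 f =
  f 0%N 0%N * detn 3 (fun i j => f i.+1 (bump 0 j))
  - f 0%N 1%N * detn 3 (fun i j => f i.+1 (bump 1 j))
  + f 0%N 2%N * detn 3 (fun i j => f i.+1 (bump 2 j))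
  - f 0%N 3%N * detn 3 (fun i j => f i.+1 (bump 3 j)).
Proof. by rewrite detnS !big_ord_recl big_ord0 /= /bump /=; ring. Qed.

(* The c-th off-diagonal position is (oi c, oj c); ok c is the third index. *)
Definition oi c := nth 0%N [:: 0; 0; 1; 1; 2; 2] c.
Definition oj c := nth 0%N [:: 1; 2; 0; 2; 0; 1] c.
Definition ok c := nth 0%N [:: 2; 1; 2; 0; 1; 0] c.

(* [off_row], [off_comm], [off_twist] and [off_twist'] are the off-diagonal
   entries of [-BA'], [AB'], [AB], [-B'A'], the number [comm_trace A B] and the
   entries of [twist A B], [twist A B'] at the transposed positions, for
   [A = diag(a)], [B = b] and adjugates [A'], [B']. *)
Section Minors.
Variables (a : nat -> F) (b : nat -> nat -> F).
Let adjb i j k : F := b i k * b k j - b i j * b k k.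

Definition off_row r c : F := match r with
  | 0 => - (b (oi c) (oj c) * (a (oi c) * a (ok c)))
  | 1 => a (oi c) * adjb (oi c) (oj c) (ok c)
  | 2 => a (oi c) * b (oi c) (oj c)
  | _ => - (adjb (oi c) (oj c) (ok c) * (a (oi c) * a (ok c)))
  end.

Definition off_twist c : F :=
  a (oj c) * a (ok c) * (a (oj c) - a (oi c)) * b (oj c) (oi c).

Definition off_twist' c : F :=
  a (oj c) * a (ok c) * (a (oj c) - a (oi c)) * adjb (oj c) (oi c) (ok c).

Definition off_comm : F :=
  \sum_(c < 6) b (oi c) (oj c) * adjb (oj c) (oi c) (ok c) * a (ok c)
    * (a (oj c) ^+ 2 - a (oi c) ^+ 2).

Definition off_vdm : F := (a 1 - a 0) * (a 2 - a 0) * (a 2 - a 1).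

(** The four rows of [off_row] are orthogonal to [off_twist] and [off_twist'], so by duality of
    Pluecker coordinates their 4 x 4 minors are proportional to the complementary 2 x 2 minors of
    these two vectors. Up to sign the factor is [off_comm] over [off_vdm]; every position is checked
    by expansion. *)
Lemma off_minor c d : (c < 6)%N -> (d < 5)%N ->
  off_vdm * ((-1) ^+ c * ((-1) ^+ d *
    detn 4 (fun r j => off_row r (bump c (bump d j)))))
  = - off_comm *
    (off_twist c * off_twist' (bump c d) - off_twist (bump c d) * off_twist' c).
Proof.
rewrite detn4 !detn3 /off_comm !big_ord_recl big_ord0.
case: c => [|[|[|[|[|[|c]]]]]] // _; case: d => [|[|[|[|[|d]]]]] // _;
  rewrite /oi /oj /ok /off_vdm /bump /= /off_twist /off_twist' /oi /oj /ok /= /adjb; ring.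
Qed.

(** Laplace expansion along the two free rows: [off_minor] evaluates each cofactor, and the terms
    regroup into a 2 x 2 determinant. *)
Lemma off_det6 (g : nat -> nat -> F) :
  (forall r c, (r < 4)%N -> (c < 6)%N -> g r.+2 c = off_row r c) ->
  off_vdm * detn 6 g = off_comm *
   ((\sum_(c < 6) off_twist' c * g 0 c) * (\sum_(c < 6) off_twist c * g 1 c)
   - (\sum_(c < 6) off_twist c * g 0 c) * (\sum_(c < 6) off_twist' c * g 1 c)).
Proof.
move=> gE; rewrite detnS big_distrr /=.
under eq_bigr => c _.
  rewrite detnS mulrCA big_distrr mulr_sumr /=.
  under eq_bigr => d _.
    rewrite (_ : off_vdm * _ = g 1 (bump c d) * (- off_comm *
    (off_twist c * off_twist' (bump c d) - off_twist (bump c d) * off_twist' c))).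
      over.
    rewrite -off_minor// (@eq_detn _ _ _ (fun r j => off_row r (bump c (bump d j)))).
      by ring.
    move=> i j i4 j4; rewrite gE // /bump; move: (ltn_ord c) (ltn_ord d); lia.
  over.
by rewrite !(big_ord_recl, big_ord0) /= /bump /=; ring.
Qed.
End Minors.

(* The seven given matrices are trace-orthogonal to [twist A B] and
   [twist A B'], so the left side, as an alternating form in [X1], [X2], is a
   multiple of the pairing with these two. *)
Lemma det9_words_diag : exists e : bool, forall A B X1 X2,
  diagonal3 A ->
  det9 [:: 1; - (B * \adj A); A * \adj B; A; - \adj A; A * B; - (\adj B * \adj A);
           X1; X2] =
  (-1) ^+ e * (comm_trace A B * pairing A B X1 X2).
Proof.
(* The diagonal matrices [1], [A], [- \adj A] and the diagonal positions 0, 4, 8 come first, then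
   [X1], [X2] and the four products. This makes the matrix block lower triangular with blocks of
   size 3 and 6. *)
pose rows := [:: 0; 3; 4; 7; 8; 1; 2; 5; 6]%N; pose cols := [:: 0; 4; 8; 1; 2; 3; 5; 6; 7]%N.
have [e1 h1] := @detn_row_reindex F 9 rows isT.
have [e2 h2] := @detn_col_reindex F 9 cols isT.
exists (e1 (+) e2) => A B X1 X2 dA.
rewrite /det9 -[LHS](signrMK e1) -h1 -[X in _ * X](signrMK e2) -h2 mulrA -signr_addb.
set Ms := [:: 1; _; _; _; _; _; _; _; _].
pose f i j := coord9 (nth 0 Ms (nth 0%N rows i)) (nth 0%N cols j).
rewrite -/(f _ _) (_ : detn 9 _ = detn 9 f) //; congr (_ * _).
have a'd := diagonal3_adj dA; have aE := ent_diagonal dA; have adE := ent_diagonal a'd.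
rewrite [detn 9 _](@detn_lower F 3 6) => [|i j i3 j6]; last first.
  by case: i i3 => [|[|[|]]]// _; case: j j6 => [|[|[|[|[|[|]]]]]]// _;
    rewrite /f /coord9 /= ?ent_opp ?ent_one ?a'd ?dA ?oppr0.
pose a i := ent A i i.
have -> : detn 3 f = - off_vdm a.
  rewrite detn3 /f /coord9 /= !ent_opp !ent_one //= !ent_adj //= /bump /= ?aE.
  by rewrite /off_vdm /a; ring.
rewrite mulNr (@off_det6 a (ent B)); last first.
  case=> [|[|[|[|r]]]] // [|[|[|[|[|[|c]]]]]] // _ _;
  rewrite /f /coord9 /off_row /oi /oj /ok /= ?ent_opp ?ent_mul ?adE ?ent_adj //= /bump /= ?aE /a;
  ring.
rewrite !big_ord_recl !big_ord0 /= /f /coord9 /=.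
have -> : off_comm a (ent B) = comm_trace A B.
  rewrite /comm_trace /off_comm /oi /oj /ok !big_ord_recl !big_ord0 /=.
  rewrite !(ent_trace, ent_mul) ?adE ?aE !ent_adj //= /bump /= ?aE /a.
  ring.
(* For diagonal [A] the diagonal entries of [twist A C] vanish, so only the six off-diagonal
   positions contribute. *)
have tE C X : \tr (twist A C * X) = \sum_(c < 6)
    (a (oj c) * a (ok c) * (a (oj c) - a (oi c)) * ent C (oj c) (oi c)) * ent X (oi c) (oj c).
  rewrite /oi /oj /ok !big_ord_recl !big_ord0 /= /twist.
  rewrite !(ent_trace, ent_mul, ent_add, ent_opp, ent_scale, ent_det, detn3) ?adE ?aE.
  rewrite !ent_adj //= /bump /= ?aE /a.
  ring.
rewrite /pairing !tE !big_ord_recl !big_ord0 /= /off_twist /off_twist' /oi /oj /ok /=.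
rewrite !ent_adj // /bump /=.
ring.
Qed.

(** For diagonal [B] the operator applied to [s] kills diagonal entries and scales each off-diagonal
    one, so only the diagonals of [Z0], [Z1], [Z2] matter. Up to sign the six scalars multiply to
    [\det B ^+ 4] times a squared Vandermonde determinant: one factor of it belongs to [det9] on the
    right, the other to the 3 x 3 determinant of traces. *)
Lemma det9_ad_diag : exists e : bool, forall B Z0 Z1 Z2 s, size s = 6%N ->
  diagonal3 B ->
  det9 ([:: Z0; Z1; Z2] ++ [seq \adj B * X * B - \det B *: X | X <- s]) =
  (-1) ^+ e * (\det B ^+ 4 * det9 ([:: 1; B; - \adj B] ++ s)
    * detn 3 (fun i j => \tr (nth 0 [:: Z0; Z1; Z2] i * nth 0 [:: 1; B; - \adj B] j))).
Proof.
have [e h] := @detn_col_reindex F 9 [:: 0; 4; 8; 1; 2; 3; 5; 6; 7] isT.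
(* Both 9 x 9 determinants undergo the same column permutation, so its sign cancels; the remaining
   minus sign is that of the product of the scalars [t]. *)
exists true => B Z0 Z1 Z2 s s6 dB; pose a i := ent B i i.
have aE := ent_diagonal dB; have adE := ent_diagonal (diagonal3_adj dB).
have detB : \det B = a 0%N * a 1%N * a 2%N.
  by rewrite ent_det detn3 !aE /a; ring.
pose t c := ent (\adj B) (oi c) (oi c) * a (oj c) - \det B.
rewrite /det9 -[LHS](signrMK e) -h (@detn_upper F 3 6); last first.
  move=> i j i6 j3; rewrite /= (nth_map 0) ?s6// /coord9.
  case: j j3 => [|[|[|]]]// _ /=;
  rewrite !(ent_mul, ent_add, ent_opp, ent_scale) ?adE ?aE detB ?ent_adj// /bump /= ?aE /a; ring.
rewrite (@eq_detn _ 6 _ (fun i j =>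
    coord9 (nth 0 s i) (nth 0%N [:: 1; 2; 3; 5; 6; 7] j) * t j)); last first.
  move=> i j i6 j6; rewrite /= (nth_map 0) ?s6// /coord9.
  case: j j6 => [|[|[|[|[|[|]]]]]]// _ /=;
  rewrite !(ent_mul, ent_add, ent_opp, ent_scale) ?adE ?aE /t /oi /oj /a /=; ring.
rewrite detn_scale_col.
rewrite -[X in _ * _ * X * _](signrMK e) -h (@detn_lower F 3 6); last first.
  move=> i j i3 j6; rewrite /coord9.
  by case: i i3 => [|[|[|]]]// _; case: j j6 => [|[|[|[|[|[|]]]]]]// _ /=;
    rewrite ?ent_opp ?ent_one ?adE ?aE ?oppr0.
have -> : detn 3 (fun i j => \tr (nth 0 [:: Z0; Z1; Z2] i * nth 0 [:: 1; B; - \adj B] j))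
  = detn 3 (fun i j => ent (nth 0 [:: Z0; Z1; Z2] i) j j) *
    detn 3 (fun j i => ent (nth 0 [:: 1; B; - \adj B] i) j j).
  rewrite detn_mul; apply: eq_detn => i j i3 j3.
  rewrite ent_trace !ent_mul !big_ord_recl big_ord0 /= /bump /=.
  by case: j j3 => [|[|[|]]]// _ /=; rewrite ?ent_opp ?ent_one ?adE ?aE //=; ring.
rewrite (detn_tr 3 (fun i j => ent (nth 0 [:: 1; B; - \adj B] i) j j)).
set d6 := detn 6 _; set dz := detn 3 (fun i j => ent (nth 0 [:: Z0; Z1; Z2] i) j j).
have -> : detn 3 (fun i j => coord9
    (nth 0 ([:: Z0; Z1; Z2] ++ [seq \adj B * X * B - \det B *: X | X <- s]) i)
    (nth 0%N [:: 0; 4; 8; 1; 2; 3; 5; 6; 7] j)) = dz.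
  apply: eq_detn => i j i3 j3; rewrite /coord9.
  by case: i i3 => [|[|[|]]]// _; case: j j3 => [|[|[|]]]// _.
have -> : detn 3 (fun i j => coord9 (nth 0 ([:: 1; B; - \adj B] ++ s) i)
  (nth 0%N [:: 0; 4; 8; 1; 2; 3; 5; 6; 7] j)) = - off_vdm a.
  rewrite detn3 /coord9 /= !ent_opp !ent_one //= !ent_adj //= /bump /= ?aE.
  by rewrite /off_vdm /a; ring.
have -> : detn 3 (fun i j => ent (nth 0 [:: 1; B; - \adj B] i) j j) = - off_vdm a.
  rewrite detn3 /= !ent_opp !ent_one //= !ent_adj //= /bump /= ?aE.
  by rewrite /off_vdm /a; ring.
have -> : \prod_(i < 6) t i = - (\det B ^+ 4 * off_vdm a ^+ 2).
  rewrite !big_ord_recl big_ord0 /t /oi /oj /= detB ?ent_adj // /bump /= ?aE /off_vdm /a.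
  ring.
rewrite expr1; ring.
Qed.
End Matrices3.

(** * Density of diagonalizable matrices *)

Section PolynomialFunctions.
Variable F : comNzRingType.
Implicit Types f g : F -> F.

Definition polyfun f := exists p : {poly F}, forall s, f s = p.[s].

Lemma polyfunC c : polyfun (fun=> c).
Proof. by exists c%:P => s; rewrite hornerC. Qed.

Lemma polyfunD f g : polyfun f -> polyfun g -> polyfun (fun s => f s + g s).
Proof. by move=> [p pE] [q qE]; exists (p + q) => s; rewrite hornerD pE qE. Qed.

Lemma polyfunM f g : polyfun f -> polyfun g -> polyfun (fun s => f s * g s).
Proof. by move=> [p pE] [q qE]; exists (p * q) => s; rewrite hornerM pE qE. Qed.

Lemma polyfunN f : polyfun f -> polyfun (fun s => - f s).
Proof. by move=> [p pE]; exists (- p) => s; rewrite hornerN pE. Qed.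

Lemma polyfun_sum (I : Type) (r : seq I) (P : pred I) (h : I -> F -> F) :
  (forall i, polyfun (h i)) -> polyfun (fun s => \sum_(i <- r | P i) h i s).
Proof.
move=> hP; elim: r => [|i r [p IH]].
  by exists 0 => s; rewrite big_nil horner0.
have [q qE] := hP i; exists (if P i then q + p else p) => s.
by rewrite big_cons IH qE; case: ifP; rewrite ?hornerD.
Qed.

Lemma polyfun_prod (I : Type) (r : seq I) (P : pred I) (h : I -> F -> F) :
  (forall i, polyfun (h i)) -> polyfun (fun s => \prod_(i <- r | P i) h i s).
Proof.
move=> hP; elim: r => [|i r [p IH]].
  by exists 1 => s; rewrite big_nil hornerC.
have [q qE] := hP i; exists (if P i then q * p else p) => s.
by rewrite big_cons IH qE; case: ifP; rewrite ?hornerM.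
Qed.

Definition polymx m n (M : F -> 'M[F]_(m, n)) := forall i j, polyfun (fun s => M s i j).

Lemma polyfun_ext f g : f =1 g -> polyfun g -> polyfun f.
Proof. by move=> fg [p pE]; exists p => s; rewrite fg. Qed.

Lemma polymxC m n (A : 'M[F]_(m, n)) : polymx (fun=> A).
Proof. by move=> i j; apply: polyfunC. Qed.

Lemma polymx_line m n (A N : 'M[F]_(m, n)) : polymx (fun s => A + s *: N).
Proof.
move=> i j; exists ((A i j)%:P + 'X * (N i j)%:P) => s.
by rewrite !mxE hornerD hornerM hornerX !hornerC.
Qed.

Lemma polymxD m n (M N : F -> 'M[F]_(m, n)) :
  polymx M -> polymx N -> polymx (fun s => M s + N s).
Proof.
move=> hM hN i j; apply: polyfun_ext (polyfunD (hM i j) (hN i j)) => s.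
by rewrite mxE.
Qed.

Lemma polymxN m n (M : F -> 'M[F]_(m, n)) : polymx M -> polymx (fun s => - M s).
Proof. by move=> hM i j; apply: polyfun_ext (polyfunN (hM i j)) => s; rewrite mxE. Qed.

Lemma polymxZ m n c (M : F -> 'M[F]_(m, n)) :
  polyfun c -> polymx M -> polymx (fun s => c s *: M s).
Proof.
by move=> hc hM i j; apply: polyfun_ext (polyfunM hc (hM i j)) => s; rewrite mxE.
Qed.

Lemma polymxM n (M N : F -> 'M[F]_n) :
  polymx M -> polymx N -> polymx (fun s => M s * N s).
Proof.
move=> hM hN i j.
apply: polyfun_ext (polyfun_sum _ _ (fun k => polyfunM (hM i k) (hN k j))) => s.
by rewrite mxE.
Qed.

Lemma polyfun_tr n (M : F -> 'M[F]_n) : polymx M -> polyfun (fun s => \tr (M s)).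
Proof. by move=> hM; apply: polyfun_sum. Qed.

Lemma polyfun_det n (M : F -> 'M[F]_n) : polymx M -> polyfun (fun s => \det (M s)).
Proof.
move=> hM; apply: polyfun_sum => s; apply: polyfunM; first exact: polyfunC.
exact: polyfun_prod.
Qed.

Lemma polymx_adj n (M : F -> 'M[F]_n) : polymx M -> polymx (fun s => \adj (M s)).
Proof.
move=> hM i j; apply: polyfun_ext (polyfunM (polyfunC ((-1) ^+ (j + i)))
  (@polyfun_det _ (fun s => row' j (col' i (M s))) _)) => [s|k l].
  by rewrite mxE.
by apply: polyfun_ext (hM (lift j k) (lift i l)) => s; rewrite !mxE.
Qed.

Lemma polyfun_detn n (f : F -> nat -> nat -> F) :
  (forall i j, polyfun (fun s => f s i j)) -> polyfun (fun s => detn n (f s)).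
Proof.
move=> hf; apply: polyfun_det => i j.
by apply: polyfun_ext (hf i j) => s; rewrite mxE.
Qed.
End PolynomialFunctions.

Section Density.
Variable F : numClosedFieldType.

(** The product with [q] vanishes everywhere, in particular at as many natural numbers as its size.
    These are distinct in characteristic 0, which is one root too many for a nonzero polynomial. *)
Lemma polyfun_eq0 (f : F -> F) (q : {poly F}) : polyfun f -> q != 0 ->
  (forall s, q.[s] != 0 -> f s = 0) -> forall s, f s = 0.
Proof.
move=> [p pE] q0 fq.
have /eqP : p * q = 0.
  apply/eqP/negPn/negP => pq_neq0.
  pose rs : seq F := [seq i%:R | i <- iota 0 (size (p * q)%R)].
  have : (size rs < size (p * q)%R)%N.
    apply: max_poly_roots => //; last first.
      by rewrite map_inj_uniq ?iota_uniq// => x y /eqP; rewrite eqr_nat => /eqP.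
    apply/allP => x _; rewrite rootE hornerM -pE.
    by have [->|/fq->] := eqVneq q.[x] 0; rewrite ?mulr0 ?mul0r.
  by rewrite size_map size_iota ltnn.
rewrite mulf_eq0 (negPf q0) orbF => /eqP p0 s.
by rewrite pE p0 horner0.
Qed.

(* A triangular matrix plus [s] times [diag(0, 1, ...)] has distinct
   eigenvalues for all but finitely many [s]. *)
Lemma diagonalizable_density n (g : 'M[F]_n.+1 -> F) :
  (forall A N, polyfun (fun s => g (A + s *: N))) ->
  (forall P D, P \in unitmx -> is_diag_mx D -> g (invmx P *m D *m P) = 0) ->
  forall A, g A = 0.
Proof.
move=> gpoly gdiag A.
have [P /unitarymx_unit Pu] := Schur A (ltn0Sn n).
rewrite /similar_to; set T := conjmx P A => Ttrig.
have AE : A = invmx P *m T *m P.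
  by rewrite /T conjumx// !mulmxA mulVmx// mul1mx -mulmxA mulVmx// mulmx1.
clearbody T.
pose N : 'M[F]_n.+1 := diag_mx (\row_i (i : nat)%:R).
(* If [s] is not a root of [q], the diagonal entries of [T + s *: N] are pairwise distinct. No
   factor is zero, as its coefficient of degree 1 is [i%:R - j%:R]. *)
pose q : {poly F} := \prod_(i < n.+1) \prod_(j < n.+1 | i != j)
  ((T i i - T j j)%:P + (i%:R - j%:R)%:P * 'X).
have q0 : q != 0.
  apply/prodf_neq0 => i _; apply/prodf_neq0 => j ij.
  apply: contraNneq ij => /(congr1 (fun p : {poly F} => p`_1)) /eqP.
  by rewrite coefD coefC coefCM coefX add0r mulr1 coef0 subr_eq0 eqr_nat.
suff : forall s, g (A + s *: (invmx P *m N *m P)) = 0.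
  by move=> /(_ 0); rewrite scale0r addr0.
apply: (polyfun_eq0 (gpoly _ _) q0) => s.
rewrite horner_prod => /prodf_neq0 qs.
have -> : A + s *: (invmx P *m N *m P) = invmx P *m (T + s *: N) *m P.
  by rewrite AE mulmxDr mulmxDl -scalemxAr -scalemxAl.
set S := T + s *: N.
have Strig : is_trig_mx S.
  apply/is_trig_mxP => i j ij; rewrite !mxE (is_trig_mxP Ttrig)//.
  by rewrite -val_eqE ltn_eqF// mulr0n mulr0 addr0.
have /diagonalizableP[Q Qu] : exists2 rs, uniq rs & mxminpoly S %| \prod_(x <- rs) ('X - x%:P).
  exists [seq S i i | i <- enum 'I_n.+1].
    rewrite map_inj_in_uniq ?enum_uniq// => i j _ _ /eqP; apply: contraTeq => ij.
    have := qs i isT; rewrite horner_prod => /prodf_neq0/(_ j ij).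
    rewrite !hornerE; apply: contraNneq => Sij; rewrite !mxE !eqxx !mulr1n in Sij.
    apply/eqP; move: Sij => /eqP; rewrite -subr_eq0 => /eqP <-; ring.
  by rewrite big_map big_enum /= -char_poly_trig// mxminpoly_dvd_char.
move=> /diagonalizable_forPex[d /(simmxRL Qu) dE].
have -> : S = invmx Q *m diag_mx d *m Q.
  by rewrite dE !mulmxA mulVmx// mul1mx -mulmxA mulVmx// mulmx1.
have -> : invmx P *m (invmx Q *m diag_mx d *m Q) *m P =
  invmx (Q *m P) *m diag_mx d *m (Q *m P).
  by rewrite (invrM Qu Pu : invmx (Q *m P) = invmx P *m invmx Q) !mulmxA.
by apply: gdiag; rewrite ?unitmx_mul ?Qu ?diag_mx_is_diag.
Qed.
End Density.

(** * Behaviour of 9 x 9 determinants under multiplication and conjugation *)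

Section Conjugation.
Variable F : fieldType.
Implicit Types (P X : 'M[F]_3) (s : seq 'M[F]_3).

Lemma adj_mul X Y : \adj (X * Y) = \adj Y * \adj X.
Proof.
apply: matrix3P => i j i3 j3.
rewrite ent_adj // ent_mul.
by case: i i3 => [|[|[|]]]// _; case: j j3 => [|[|[|]]]// _ /=;
  rewrite !ent_mul !ent_adj //= /bump /=; ring.
Qed.

Lemma adj_conj P X : P \in unitmx ->
  \adj (P^-1 * X * P) = P^-1 * \adj X * P.
Proof.
move=> Pu; have adjE Q : Q \in unitmx -> \adj Q = \det Q *: Q^-1.
  move=> Qu; rewrite -[\adj Q]mul1r -(mulVr Qu) -mulrA.
  by rewrite [Q * \adj Q]mul_mx_adj [_ * _]mul_mx_scalar.
rewrite !adj_mul (adjE _ _ P)// (adjE _ _ P^-1) ?unitmx_inv// (det_inv P : \det P^-1 = _) invrK.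
rewrite -scalerAl -!scalerAr scalerA mulfV ?scale1r ?mulrA//.
by rewrite -unitfE -unitmxE.
Qed.

Lemma coord9_mulr X P c : (c < 9)%N -> coord9 (X * P) c =
  \sum_(l < 9) coord9 X l * (if (l %/ 3 == c %/ 3)%N then ent P (l %% 3) (c %% 3) else 0).
Proof.
rewrite !big_ord_recl big_ord0 /bump /= /coord9.
by case: c => [|[|[|[|[|[|[|[|[|c]]]]]]]]] // _ /=; rewrite ent_mul; ring.
Qed.

Lemma coord9_mull X P c : (c < 9)%N -> coord9 (P * X) c =
  \sum_(l < 9) coord9 X l * (if (l %% 3 == c %% 3)%N then ent P (c %/ 3) (l %/ 3) else 0).
Proof.
rewrite !big_ord_recl big_ord0 /bump /= /coord9.
by case: c => [|[|[|[|[|[|[|[|[|c]]]]]]]]] // _ /=; rewrite ent_mul; ring.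
Qed.

(** In row-major coordinates right multiplication is block diagonal with three copies of [P]. *)
Lemma det9_mulr P s : size s = 9%N -> det9 [seq X * P | X <- s] = \det P ^+ 3 * det9 s.
Proof.
move=> s9; rewrite mulrC.
pose f l c := if (l %/ 3 == c %/ 3)%N then ent P (l %% 3) (c %% 3) else 0.
have -> : \det P ^+ 3 = detn 9 f.
  rewrite (@detn_lower _ 3 6) => [|[|[|[|i]]] [|[|[|[|[|[|j]]]]]]//].
  rewrite (@detn_lower _ 3 3) => [|[|[|[|i]]] [|[|[|j]]]//].
  rewrite ent_det exprS expr2; congr (_ * (_ * _)); apply: eq_detn;
  by case=> [|[|[|i]]] // [|[|[|j]]].
rewrite detn_mul; apply: eq_detn => i j i9 j9.
by rewrite (nth_map 0) ?s9// coord9_mulr.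
Qed.

Lemma det9_mull P s : size s = 9%N -> det9 [seq P * X | X <- s] = \det P ^+ 3 * det9 s.
Proof.
move=> s9; rewrite mulrC.
pose f l c := if (l %% 3 == c %% 3)%N then ent P (c %/ 3) (l %/ 3) else 0.
have -> : \det P ^+ 3 = detn 9 f.
  (* Passing to column-major order makes left multiplication block diagonal, with three copies of
     the transpose of [P]. *)
  rewrite -(@detn_reindex _ 9 [:: 0; 3; 6; 1; 4; 7; 2; 5; 8]%N)//.
  rewrite (@detn_lower _ 3 6) => [|[|[|[|i]]] [|[|[|[|[|[|j]]]]]]//].
  rewrite (@detn_lower _ 3 3) => [|[|[|[|i]]] [|[|[|j]]]//].
  rewrite -[P]trmxK det_tr ent_det exprS expr2; congr (_ * (_ * _)); apply: eq_detn;
  by case=> [|[|[|i]]] // [|[|[|j]]] // _ _; rewrite /f /= /ent mxE.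
rewrite detn_mul; apply: eq_detn => i j i9 j9.
by rewrite (nth_map 0) ?s9// coord9_mull.
Qed.
End Conjugation.

(** * The determinant identities for arbitrary matrices *)

Section Identities.
Variable F : numClosedFieldType.
Implicit Types (A B P X Z : 'M[F]_3) (s : seq 'M[F]_3).

Lemma det9_conj P s : P \in unitmx -> size s = 9%N ->
  det9 [seq P^-1 * X * P | X <- s] = det9 s.
Proof.
move=> Pu s9; rewrite (map_comp (fun X => X * P) (fun X => P^-1 * X)).
rewrite det9_mulr ?size_map// det9_mull// mulrA -exprMn (det_inv P : \det P^-1 = _).
by rewrite mulfV ?expr1n ?mul1r// -unitfE -unitmxE.
Qed.

Lemma conj1 P : P \in unitmx -> P^-1 * 1 * P = 1.
Proof. by move=> Pu; rewrite mulr1 mulVr. Qed.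

Lemma conjM P X Y : P \in unitmx -> P^-1 * (X * Y) * P = (P^-1 * X * P) * (P^-1 * Y * P).
Proof. by move=> Pu; rewrite -!mulrA (mulrA P P^-1) mulrV// mul1r. Qed.

Lemma conjN P X : P^-1 * (- X) * P = - (P^-1 * X * P).
Proof. by rewrite mulrN mulNr. Qed.

Lemma tr_conj P X : P \in unitmx -> \tr (P^-1 * X * P) = \tr X.
Proof. by move=> Pu; rewrite -mulrA tr_mulC -mulrA mulrV// mulr1. Qed.

Lemma det_conj P X : P \in unitmx -> \det (P^-1 * X * P) = \det X.
Proof.
move=> Pu; rewrite !det_mulmx (det_inv P : \det P^-1 = _) mulrC mulrA mulfV ?mul1r//.
by rewrite -unitfE -unitmxE.
Qed.

Lemma conjK P X : P \in unitmx -> P^-1 * (P * X * P^-1) * P = X.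
Proof. by move=> Pu; rewrite !mulrA mulVr// mul1r -mulrA mulVr// mulr1. Qed.

Lemma diag_ent A : is_diag_mx A ->
  diagonal3 A.
Proof.
by move=> dA i j i3 j3 ij; rewrite /ent (is_diag_mxP dA)// !inordK.
Qed.

Lemma polyfun_det9 (s : F -> seq 'M[F]_3) :
  (forall i, polymx (fun t => nth 0 (s t) i)) -> polyfun (fun t => det9 (s t)).
Proof. by move=> hs; apply: polyfun_detn => i j; apply: hs. Qed.

Ltac poly_tac := repeat first
  [ exact: polymx_line | exact: polymxC
  | apply: polyfunD | apply: polyfunN | apply: polyfunM | apply: polyfun_tr
  | apply: polyfun_det | apply: polymxD | apply: polymxN | apply: polymxZ
  | apply: polymxM | apply: polymx_adj ].

(** Both sides are polynomial in [A] and unchanged when all matrices are conjugated simultaneously,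
    so density reduces the identity to [det9_words_diag]. *)
Lemma det9_words : exists e : bool, forall A B X1 X2,
  det9 [:: 1; - (B * \adj A); A * \adj B; A; - \adj A; A * B; - (\adj B * \adj A);
           X1; X2] =
  (-1) ^+ e * (comm_trace A B * pairing A B X1 X2).
Proof.
have [e he] := det9_words_diag F; exists e => A B X1 X2; apply/eqP; rewrite -subr_eq0; apply/eqP.
move: A; apply: diagonalizable_density => [A N|P D Pu Dd].
  apply: polyfunD; first by apply: polyfun_det9 => -[|[|[|[|[|[|[|[|[|i]]]]]]]]] /=; poly_tac.
  rewrite /comm_trace /pairing /twist; apply: polyfunN; apply: polyfunM; first exact: polyfunC.
  by poly_tac.
rewrite -[invmx P *m D *m P]/(P^-1 * D * P).
rewrite -(conjK X1 Pu) -(conjK X2 Pu) -(conjK B Pu).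
move: (P * X1 / P) (P * X2 / P) (P * B / P) => {X1 X2 B} X1 X2 B.
have eD := diag_ent Dd.
apply/eqP; rewrite subr_eq0; apply/eqP.
rewrite /comm_trace /pairing /twist !adj_conj// !det_conj//.
rewrite -!(conjM _ _ Pu) -!conjN -(conj1 Pu).
have cZ c X Y : P^-1 * X * P - c *: (P^-1 * Y * P) = P^-1 * (X - c *: Y) * P.
  by rewrite mulrBr mulrBl -scalerAr -scalerAl.
rewrite !cZ -!(conjM _ _ Pu) !tr_conj// -he//.
by rewrite -[RHS](det9_conj Pu).
Qed.

(** The same reduction, now with [B] as the matrix to be diagonalized. It serves to evaluate the
    auxiliary functionals on coboundaries. *)
Lemma det9_ad : exists e : bool, forall B Z0 Z1 Z2 s, size s = 6%N ->
  det9 ([:: Z0; Z1; Z2] ++ [seq \adj B * X * B - \det B *: X | X <- s]) =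
  (-1) ^+ e * (\det B ^+ 4 * det9 ([:: 1; B; - \adj B] ++ s)
    * detn 3 (fun i j => \tr (nth 0 [:: Z0; Z1; Z2] i * nth 0 [:: 1; B; - \adj B] j))).
Proof.
have [e he] := det9_ad_diag F; exists e => B Z0 Z1 Z2 s s6; apply/eqP; rewrite -subr_eq0; apply/eqP.
move: B; apply: diagonalizable_density => [A N|P D Pu Dd].
  apply: polyfunD.
    apply: polyfun_det9 => -[|[|[|i]]] /=; poly_tac.
    have [i6|i6] := ltnP i (size s); last first.
      by move=> k l; apply: polyfun_ext (polyfunC 0) => t; rewrite nth_default ?size_map// mxE.
    move=> k l; apply: (polyfun_ext (g := fun t =>
      (\adj (A + t *: N) * s`_i * (A + t *: N) - \det (A + t *: N) *: s`_i) k l)).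
      by move=> t; rewrite (nth_map 0).
    by move: k l; poly_tac.
  apply: polyfunN; apply: polyfunM; first exact: polyfunC.
  apply: polyfunM.
    apply: polyfunM; first by rewrite /=; poly_tac.
    by apply: polyfun_det9 => -[|[|[|i]]] /=; poly_tac.
  by apply: polyfun_detn => i [|[|[|j]]] /=; poly_tac.
rewrite -[invmx P *m D *m P]/(P^-1 * D * P).
apply/eqP; rewrite subr_eq0; apply/eqP.
have [t [sE t6]] : exists t, s = [seq P^-1 * X * P | X <- t] /\ size t = 6%N.
  exists [seq P * X * P^-1 | X <- s]; split; last by rewrite size_map.
  by rewrite -map_comp map_id_in// => X _; rewrite /= conjK.
rewrite {s s6}sE -(conjK Z0 Pu) -(conjK Z1 Pu) -(conjK Z2 Pu).
move: (P * Z0 / P) (P * Z1 / P) (P * Z2 / P) => {Z0 Z1 Z2} Z0 Z1 Z2.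
rewrite !adj_conj// !det_conj// -!conjN -(conj1 Pu).
have -> : [seq P^-1 * \adj D * P * X * (P^-1 * D * P) - \det D *: X
    | X <- [seq P^-1 * X * P | X <- t]]
  = [seq P^-1 * X * P | X <- [seq \adj D * X * D - \det D *: X | X <- t]].
  rewrite -!map_comp; apply: eq_map => X /=.
  by rewrite mulrBr mulrBl -scalerAr -scalerAl !conjM// mulrA.
rewrite -[[:: _; _; _]](map_cons (fun X => P^-1 * X * P) Z0 [:: Z1; Z2]) -map_cat.
rewrite det9_conj ?size_cat ?size_map ?t6//.
rewrite -[[:: P^-1 * 1 * P; _; _]](map_cons (fun X => P^-1 * X * P) 1 [:: D; - \adj D]) -map_cat.
rewrite det9_conj ?size_cat ?t6// he//; last exact: diag_ent.
congr (_ * (_ * _)); apply: eq_detn => i j i3 j3.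
by case: i i3 => [|[|[|]]]// _; case: j j3 => [|[|[|]]]// _;
  rewrite /= -conjM ?tr_conj.
Qed.
End Identities.

(** * Gram determinants *)

Section Gram.
Variable F : numFieldType.
Implicit Types (G H : seq 'M[F]_3) (A B X : 'M[F]_3).

(** In entry coordinates the trace form is the permutation matrix of transposition, which swaps
    three pairs of positions and so has determinant -1. *)
Lemma det9_gram G H :
  detn 9 (fun i j => \tr (nth 0 G i * nth 0 H j)) = - (det9 G * det9 H).
Proof.
pose S (i j : nat) : F := (j == nth 0%N [:: 0; 3; 6; 1; 4; 7; 2; 5; 8] i)%:R.
have detS : detn 9 S = -1.
  rewrite -(@detn_reindex _ 9 [:: 0; 4; 8; 1; 3; 2; 6; 5; 7]%N)//.
  rewrite (@detn_lower _ 3 6) => [|[|[|[|i]]] [|[|[|[|[|[|j]]]]]]//].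
  rewrite (@detn_lower _ 2 4) => [|[|[|i]] [|[|[|[|j]]]]//].
  rewrite (@detn_lower _ 2 2) => [|[|[|i]] [|[|j]]//].
  by rewrite detn3 !detn2 /S /=; ring.
rewrite /det9 -(detn_tr 9 (fun r c => coord9 (nth 0 H r) c)) -mulN1r -detS mulrA.
rewrite [detn 9 S * _]mulrC !detn_mul; apply: eq_detn => i j _ _.
rewrite ent_trace !ent_mul !big_ord_recl !big_ord0 /S /coord9 /bump /=; ring.
Qed.

(** The Gram matrix of [1 :: c] for the trace form has diagonal 3, -1, ..., -1 and zeros elsewhere,
    hence determinant 3. *)
Lemma det9_orthonormal (c : seq 'M[F]_3) : size c = 8%N ->
  (forall i, (i < 8)%N -> \tr (nth 0 c i) = 0) ->
  (forall i j, (i < 8)%N -> (j < 8)%N -> - \tr (nth 0 c i * nth 0 c j) = (i == j)%:R) ->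
  det9 (1 :: c) ^+ 2 = -3.
Proof.
move=> c8 c0 cON; apply: oppr_inj; rewrite opprK expr2 -det9_gram.
rewrite (@detn_lower _ 1 8) => [|[|i] j //= _ j8]; last by rewrite mul1r c0.
rewrite (@eq_detn _ 8 _ (fun i j => - 1 * (i == j)%:R)); last first.
  by move=> i j i8 j8; rewrite !add1n /= -cON// mulN1r opprK.
rewrite detn_scale_row prodr_const card_ord exprNn expr1n mulr1.
have -> : detn 8 (fun i j => (i == j)%:R) = 1 :> F.
  by rewrite -[RHS](det1 F 8); congr (\det _); apply/matrixP => i j; rewrite !mxE.
by rewrite detnS big_ord_recl big_ord0 detn0 /= mulr1 mxtrace1; ring.
Qed.

(** Bordering by the identity matrix adds a first column with single nonzero entry 3, so [det9_gram]
    applies; since the square of [det9 (1 :: c)] is -3, dividing by -3 turns this factor into its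
    inverse. *)
Lemma detn8_det9 (c : seq 'M[F]_3) G :
  size c = 8%N -> (forall i, (i < 8)%N -> \tr (nth 0 c i) = 0) ->
  det9 (1 :: c) ^+ 2 = -3 ->
  detn 8 (fun i j => \tr (nth 0 c i * nth 0 G j)) = (det9 (1 :: c))^-1 * det9 (1 :: G).
Proof.
move=> c8 c0 c2; have := det9_gram (1 :: c) (1 :: G).
rewrite (@detn_upper _ 1 8) => [|i [|j] //= i8 _]; last by rewrite mulr1 c0.
rewrite (_ : detn 1 _ = 3); last first.
  by rewrite detnS big_ord_recl big_ord0 detn0 /= mulr1 mxtrace1; ring.
rewrite /= => h.
have c_neq0 : det9 (1 :: c) != 0.
  by apply: contra_eq_neq c2 => ->; rewrite expr2 mul0r eq_sym oppr_eq0 pnatr_eq0.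
apply: (mulfI c_neq0); rewrite mulVKf//.
have n3 : (3 : F) != 0 by rewrite pnatr_eq0.
apply: (mulfI n3); rewrite mulrCA h mulrN mulrA -expr2 c2; ring.
Qed.

(* [tr(B A X A') - tr(A B A' X)] vanishes at [X = 1] and [X = B], and similarly
   for the first occurrence of [B]. *)
Lemma comm_trace_free A B (v0 v1 v2 : F) : \det A = 1 -> \det B = 1 -> comm_trace A B != 0 ->
  v0 *: 1 + v1 *: B + v2 *: \adj B = 0 -> [/\ v0 = 0, v1 = 0 & v2 = 0].
Proof.
move=> dA dB ct v_eq0.
have AA' : A * \adj A = 1 by rewrite [A * _]mul_mx_adj dA.
have A'A : \adj A * A = 1 by rewrite [_ * A]mul_adj_mx dA.
have trC X Y : \tr (X * Y) = \tr (Y * X) by exact: mxtrace_mulC.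
have v2_0 : v2 = 0.
  have := congr1 (fun X => \tr (B * A * X * \adj A) - \tr (A * B * \adj A * X)) v_eq0.
  rewrite !mulr0 !mul0r !mxtrace0 subrr.
  rewrite !(mulrDr, mulrDl) -!(scalerAr, scalerAl) !mulr1 !mxtraceD !mxtraceZ.
  have -> : \tr (B * A * \adj A) = \tr B by rewrite -mulrA AA' mulr1.
  have -> : \tr (A * B * \adj A) = \tr B by rewrite trC mulrA A'A mul1r.
  have -> : \tr (A * B * \adj A * B) = \tr (B * A * B * \adj A) by rewrite trC !mulrA.
  move=> h; apply/eqP; move: ct; apply: contraNT => v2_neq0.
  apply/eqP; apply: (mulfI v2_neq0); rewrite mulr0 -h /comm_trace !mulrA; ring.
have v1_0 : v1 = 0.
  have := congr1 (fun X => \tr (X * A * \adj B * \adj A) - \tr (A * X * \adj A * \adj B)) v_eq0.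
  rewrite v2_0 scale0r addr0.
  rewrite !mulr0 !mul0r !mxtrace0 subrr.
  rewrite !(mulrDr, mulrDl) -!(scalerAr, scalerAl) ?mulr1 ?mul1r !mxtraceD !mxtraceZ.
  have -> : \tr (A * \adj B * \adj A) = \tr (\adj B) by rewrite trC mulrA A'A mul1r.
  have -> : \tr (A * \adj A * \adj B) = \tr (\adj B) by rewrite AA' mul1r.
  move=> h; apply/eqP; move: ct; apply: contraNT => v1_neq0.
  apply/eqP; apply: (mulfI v1_neq0); rewrite mulr0 -h /comm_trace !mulrA; ring.
split=> //; move: v_eq0; rewrite v1_0 v2_0 !scale0r !addr0 => /(congr1 (fun X => ent X 0 0)).
by rewrite ent_scale ent_one// mulr1 /ent mxE.
Qed.

(** This determinant is a common factor of both sides of the final comparison; a choice of [s] that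
    makes it nonzero allows it to be cancelled. *)
Lemma det9_extension A B : \det A = 1 -> \det B = 1 -> comm_trace A B != 0 ->
  exists s, size s = 6%N /\ det9 ([:: 1; B; - \adj B] ++ s) != 0.
Proof.
move=> dA dB ct.
pose K : 'M[F]_(3, 3 + 6) := \matrix_(i < 3, j < 9) coord9 (nth 0 [:: 1; B; - \adj B] i) j.
have Kfree : row_free K.
  rewrite -kermx_eq0; apply/rowV0P => v /sub_kermxP vK.
  pose w n := v 0 (inord n).
  have vw l : v 0 l = w l by rewrite /w inord_val.
  have vB : w 0%N *: 1 + w 1%N *: B + (- w 2) *: \adj B = 0.
    apply: matrix3P => i j i3 j3.
    have ij9 : (3 * i + j < 9)%N by lia.
    have posE : nth (0%N, 0%N) pos9 (3 * i + j) = (i, j).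
      by case: i i3 {ij9} => [|[|[|]]]//; case: j j3 => [|[|[|]]].
    transitivity ((v *m K) 0 (Ordinal ij9)); last by rewrite vK mxE /ent mxE.
    rewrite mxE; under eq_bigr do rewrite vw mxE /coord9 posE /=.
    rewrite !big_ord_recl big_ord0 /bump /=.
    by rewrite !ent_add !ent_scale ent_opp addr0 mulNr mulrN addrA.
  have [w0 w1 w2] := comm_trace_free dA dB ct vB.
  apply/rowP => l; rewrite mxE vw; case: l => l l3 /=; case: l l3 => [|[|[|l]]] // _.
  by apply: oppr_inj; rewrite oppr0 -w2.
(* Since [K] has full row rank, it is [col_ebase K] times the first three rows of the invertible
   [U]; the other six rows of [U] complete it to an invertible matrix. *)
pose U : 'M[F]_(3 + 6, 9) := row_ebase K.
pose E : 'M[F]_(3 + 6) := block_mx (col_ebase K) 0 0 1%:M.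
pose s := [seq (\matrix_(i < 3, j < 3) dsubmx U r (inord (3 * i + j))) : 'M[F]_3 | r <- enum 'I_6].
exists s; split; first by rewrite size_map size_enum_ord.
have -> : det9 ([:: 1; B; - \adj B] ++ s) = \det (E *m U).
  have -> : E *m U = col_mx K (dsubmx U).
    rewrite /E -[X in _ *m X]vsubmxK mul_block_col !mul0mx add0r mul1mx addr0.
    congr (col_mx _ _); rewrite -[RHS]mulmx_ebase (eqP Kfree).
    rewrite -mulmxA; congr (_ *m _); rewrite -[row_ebase K]/U -[X in _ *m X]vsubmxK.
    rewrite (_ : pid_mx 3 = row_mx 1%:M 0) ?mul_row_col ?mul0mx ?mul1mx ?addr0//.
    apply/matrixP => i j; rewrite mxE [RHS]mxE ltn_ord andbT.
    case: splitP => j' ->; rewrite !mxE ?val_eqE//.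
    by rewrite ltn_eqF// (leq_trans (ltn_ord i)) ?leq_addr.
  congr (\det _); apply/matrixP => i j; rewrite [RHS]mxE mxE; case: splitP => i' ->.
    by rewrite mxE; case: i' => a a3 /=; case: a a3 => [|[|[|a]]].
  rewrite nth_cat /= addKn /s (nth_map i') ?size_enum_ord// nth_ord_enum.
  rewrite /coord9 /ent mxE; congr (dsubmx U _ _); apply: val_inj => /=.
  by case: j => -[|[|[|[|[|[|[|[|[|j]]]]]]]]] // j9; rewrite /= !inordK //.
rewrite det_mulmx (@det_ublock F 3 6) det1 mulr1 -unitfE unitrM -!unitmxE.
by rewrite col_ebase_unit row_ebase_unit.
Qed.
End Gram.

(** * Derivatives of trace functions *)

Section MatrixDerivatives.
Local Open Scope classical_set_scope.
Variable K : numFieldType.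

Lemma cvg_mx (T : Type) (G : set_system T) (FG : Filter G) m n
  (f : T -> 'M[K]_(m, n)) (l : 'M[K]_(m, n)) :
  (forall i j, f x i j @[x --> G] --> l i j) -> f x @[x --> G] --> l.
Proof.
move=> fl A [P nP PA]; rewrite /= nbhs_simpl /=.
apply: filterS (fun x => PA (f x)) _ => /=.
apply: filter_forall => i; apply: filter_forall => j.
exact: (fl i j _ (nP i j)).
Qed.

Lemma is_derive_mxP m n (M : K -> 'M[K]_(m.+1, n.+1)) (D : 'M[K]_(m.+1, n.+1)) (x : K) :
  is_derive x 1 M D <-> (forall i j, is_derive x 1 (fun s => M s i j) (D i j)).
Proof.
split=> [MD i j|MD].
  have MDcvg : h^-1 *: (M (h *: 1 + x) - M x) @[h --> 0^'] --> D.
    by rewrite -(@derive_val _ _ _ _ _ _ _ MD); exact: (@ex_derive _ _ _ _ _ _ _ MD).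
  have ijcvg : h^-1 *: (M (h *: 1 + x) i j - M x i j) @[h --> 0^'] --> D i j.
    have := cvg_comp _ _ MDcvg (@coord_continuous K m.+1 n.+1 i j D).
    by under [X in X @ _ --> _]eq_fun do rewrite /= !mxE.
  by split; [apply/cvg_ex; exists (D i j)|exact: cvg_lim ijcvg].
have MDcvg : h^-1 *: (M (h *: 1 + x) - M x) @[h --> 0^'] --> D.
  apply: cvg_mx => i j.
  rewrite -(@derive_val _ _ _ _ _ _ _ (MD i j)).
  have := @ex_derive _ _ _ _ _ _ _ (MD i j).
  rewrite /derivable /derive; under [in X in _ -> X]eq_fun do rewrite !mxE.
  exact.
by split; [apply/cvg_ex; exists D|exact: cvg_lim MDcvg].
Qed.

Lemma is_derive_mxM n (M N : K -> 'M[K]_n.+1) DM DN (x : K) :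
  is_derive x 1 M DM -> is_derive x 1 N DN ->
  is_derive x 1 (fun s => M s * N s) (DM * N x + M x * DN).
Proof.
move=> /is_derive_mxP hM /is_derive_mxP hN; apply/is_derive_mxP => i j.
have -> : (fun s => (M s * N s) i j) =
  \sum_(k < n.+1) ((fun s => M s i k) * (fun s => N s k j)).
  by apply/funext => s; rewrite mxE fct_sumE.
apply: is_derive_eq; rewrite !mxE -big_split /=.
by apply: eq_bigr => k _; rewrite addrC; congr (_ + _); exact: mulrC.
Qed.

Lemma is_derive_mxtr n (M : K -> 'M[K]_n.+1) DM (x : K) :
  is_derive x 1 M DM -> is_derive x 1 (fun s => \tr (M s)) (\tr DM).
Proof.
move=> /is_derive_mxP hM.
have -> : (fun s => \tr (M s)) = \sum_(k < n.+1) (fun s => M s k k).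
  by apply/funext => s; rewrite fct_sumE.
exact: is_derive_eq.
Qed.

(** Existence suffices here: the value is recovered in [is_derive_letter] by the product rule. *)
Lemma derivable_adj (M : K -> 'M[K]_3) D (x : K) :
  is_derive x 1 M D -> exists D', is_derive x 1 (fun s => \adj (M s)) D'.
Proof.
move=> /is_derive_mxP hM.
have dent a b : derivable (fun s => ent (M s) a b) x 1.
  by have [] := hM (inord a) (inord b).
have dadj i j : derivable (fun s => \adj (M s) i j) x 1.
  rewrite (_ : (fun s => _) = cst ((-1) ^+ (j + i)) *
    ((fun s => ent (M s) (bump j 0) (bump i 0)) * (fun s => ent (M s) (bump j 1) (bump i 1))
     - (fun s => ent (M s) (bump j 0) (bump i 1)) * (fun s => ent (M s) (bump j 1) (bump i 0)))).
    by apply: derivableM => //; apply: derivableB; apply: derivableM.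
  by apply/funext => s; rewrite entE ent_adj.
exists (\matrix_(i, j) 'D_1 (fun s => \adj (M s) i j) x).
by apply/is_derive_mxP => i j; rewrite mxE; exact: derivableP.
Qed.

(** Jacobi's formula; with constant determinant 1 it shows that velocities are traceless. *)
Lemma is_derive_det (M : K -> 'M[K]_3) D (x : K) :
  is_derive x 1 M D -> is_derive x 1 (fun s => \det (M s)) (\tr (D * \adj (M x))).
Proof.
move=> /is_derive_mxP hM.
pose f a b := fun s => ent (M s) a b.
have df a b : is_derive x 1 (f a b) (ent D a b) by exact: hM.
have d2 a b c d := is_deriveB (is_deriveM (df a b) (df c d)) (is_deriveM (df a d) (df c b)).
have dd := is_deriveD (is_deriveB (is_deriveM (df 0 0)%N (d2 1 1 2 2)%N)
  (is_deriveM (df 0 1)%N (d2 1 0 2 2)%N)) (is_deriveM (df 0 2)%N (d2 1 0 2 1)%N).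
rewrite (_ : (fun s => _) = f 0%N 0%N * (f 1%N 1%N * f 2%N 2%N - f 1%N 2%N * f 2%N 1%N)
  - f 0%N 1%N * (f 1%N 0%N * f 2%N 2%N - f 1%N 2%N * f 2%N 0%N)
  + f 0%N 2%N * (f 1%N 0%N * f 2%N 1%N - f 1%N 1%N * f 2%N 0%N)); last first.
  by apply/funext => s; rewrite ent_det detn3.
apply: (is_derive_eq dd).
rewrite ent_trace !ent_mul !ent_adj //= /bump /= /GRing.scale /= !fctE /f.
ring.
Qed.

End MatrixDerivatives.

Section Velocity.
Variables (R : realType) (k : nat).
Local Notation C := (Cplx R).
Implicit Types (rho : gens R k) (p : curve R k) (u : {ffun 'I_k -> 'M[C]_3}).

(* [dev rho u w] is the derivative of [ev rho w] along the cocycle [u]. *)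
Definition dletter rho u (l : 'I_k * bool) : 'M[C]_3 :=
  if l.2 then - ((rho l.1)^-1 * u l.1) else u l.1 * rho l.1.

Fixpoint dev rho u (w : word k) : 'M[C]_3 :=
  if w is l :: w' then
    dletter rho u l * ev rho w' + ev rho [:: l] * dev rho u w'
  else 0.

Lemma ev_cons rho l w : ev rho (l :: w) = ev rho [:: l] * ev rho w.
Proof. by rewrite /ev !big_cons big_nil mulr1. Qed.

Lemma SL3_unit (A : 'M[C]_3) : \det A = 1 -> A \is a GRing.unit.
Proof. by move=> dA; have : A \in unitmx by rewrite unitmxE dA unitr1. Qed.

Lemma velocity_derive rho p i : is_SL3_rep rho -> curve_at rho p ->
  is_derive (0 : C) 1 (fun s => p s i) (velocity rho p i * rho i).
Proof.
move=> hrho [pS p0 pD].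
have := derivableP (pD i) => dp.
have dq : is_derive (0 : C) 1 (fun s => p s i * (rho i)^-1) ('D_1 (fun s => p s i) 0 * (rho i)^-1).
  have := is_derive_mxM dp (is_derive_cst ((rho i)^-1) (0 : C) 1).
  by rewrite mulr0 addr0.
rewrite /velocity ffunE derive1E (@derive_val _ _ _ _ _ _ _ dq).
by rewrite -mulrA mulVr ?mulr1 //; exact: SL3_unit.
Qed.

Lemma adj_SL3 (A : 'M[C]_3) : \det A = 1 -> A^-1 = \adj A.
Proof.
move=> dA; rewrite -[LHS]mulr1 -[1]/(1%:M) -dA -mul_mx_adj -[_ *m _]/(A * \adj A).
by rewrite mulrA mulVr ?mul1r// SL3_unit.
Qed.

Lemma is_derive_letter rho p l : is_SL3_rep rho -> curve_at rho p ->
  is_derive (0 : C) 1 (fun s => ev (p s) [:: l]) (dletter rho (velocity rho p) l).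
Proof.
move=> hrho hp; have [pS p0 pD] := hp; have dp := velocity_derive l.1 hrho hp.
case: l dp => i [] /= dp; rewrite /dletter /ev /=; last first.
  by under eq_fun do rewrite big_cons big_nil mulr1.
under eq_fun do rewrite big_cons big_nil mulr1 /= (adj_SL3 (pS _ _)).
have [D' dD'] := derivable_adj dp.
(* Differentiating the constant product of [p s i] and its adjugate identifies [D']. *)
have := is_derive_mxM dp dD'.
under eq_fun do rewrite [_ * _]mul_mx_adj pS.
move=> dc; have := @derive_val _ _ _ _ _ _ _ dc.
rewrite derive_cst !p0 -adj_SL3// => /eqP; rewrite eq_sym addr_eq0 => /eqP E.
have -> // : - ((rho i)^-1 * velocity rho p i) = D'.
have ru := SL3_unit (hrho i).
apply: (mulrI ru); rewrite mulrN mulVKr//; apply/eqP; rewrite eqr_oppLR; apply/eqP.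
by rewrite -E mulrK.
Qed.

Lemma is_derive_ev rho p w : is_SL3_rep rho -> curve_at rho p ->
  is_derive (0 : C) 1 (fun s => ev (p s) w) (dev rho (velocity rho p) w).
Proof.
move=> hrho hp; elim: w => [|l w IH] /=.
  by under eq_fun do rewrite /ev big_nil; exact: is_derive_cst.
under eq_fun do rewrite ev_cons.
have := is_derive_mxM (is_derive_letter l hrho hp) IH.
have evp0 v : ev (p 0) v = ev rho v.
  by have [_ p0 _] := hp; apply: eq_bigr => a _; rewrite !p0.
by rewrite !evp0.
Qed.

Lemma differential_tau rho p w : is_SL3_rep rho -> curve_at rho p ->
  differential (tau w) p = \tr (dev rho (velocity rho p) w).
Proof.
move=> hrho hp; rewrite /differential derive1E.
by rewrite (@derive_val _ _ _ _ _ _ _ (is_derive_mxtr (is_derive_ev w hrho hp))).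
Qed.

Lemma tr_velocity rho p i : is_SL3_rep rho -> curve_at rho p ->
  \tr (velocity rho p i) = 0.
Proof.
move=> hrho hp; have [pS p0 pD] := hp.
have dp := velocity_derive i hrho hp.
set v := velocity rho p i in dp *.
have ddet := is_derive_det dp.
have := @derive_val _ _ _ _ _ _ _ ddet.
under eq_fun do rewrite pS.
by rewrite derive_cst !p0 -mulrA [rho i * _]mul_mx_adj hrho mulr1.
Qed.
End Velocity.

(** * Change of basis and block determinants *)

Section BasisDet.
Variables (R : realType) (V : vectType (Cplx R)).
Local Notation C := (Cplx R).

(** Expanding [a] in [b] factors the matrix of values of the functionals on [a] as coordinates times
    values on [b]. So [Omega] can be computed without knowing any coordinates. *)
Lemma basis_det_mul m (a : seq V) (b : m.-tuple V) (psi : nat -> V -> C) :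
  (forall c u v, psi c (u + v) = psi c u + psi c v) ->
  (forall c x u, psi c (x *: u) = x * psi c u) ->
  (forall i, (i < m)%N -> a`_i \in <<b>>%VS) ->
  basis_det a b * detn m (fun l c => psi c b`_l) = detn m (fun i c => psi c a`_i).
Proof.
move=> psiD psiZ ab; have psi0 c : psi c 0 = 0 by rewrite -(scale0r 0) psiZ mul0r.
rewrite /basis_det /detn -det_mulmx; congr (\det _); apply/matrixP => i j.
rewrite !mxE [in RHS](coord_span (ab i (ltn_ord i))) (big_morph (psi j) (psiD j) (psi0 j)).
by apply: eq_bigr => l _; rewrite !mxE psiZ.
Qed.
End BasisDet.

Lemma nth_allpairs (S T U : Type) (s0 : S) (t0 : T) (u0 : U) (f : S -> T -> U) s t i j :
  (i < size s)%N -> (j < size t)%N ->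
  nth u0 [seq f x y | x <- s, y <- t] (i * size t + j) = f (nth s0 s i) (nth t0 t j).
Proof.
elim: s i => [|x s IH] [|i] // si tj; rewrite allpairs_cons nth_cat size_map.
  by rewrite mul0n add0n tj (nth_map t0).
rewrite mulSn -addnA ltnNge leq_addr /= addKn; exact: IH.
Qed.

Lemma nth_flatten_const (T : Type) (x0 : T) n (ss : seq (seq T)) i j :
  all (fun s => size s == n) ss -> (j < n)%N ->
  nth x0 (flatten ss) (n * i + j) = nth x0 (nth [::] ss i) j.
Proof.
elim: ss i => [|s ss IH] [|i] //= => [|||]; rewrite ?nth_nil// => /andP[/eqP sn ssn] jn.
  by rewrite muln0 nth_cat sn jn.
by rewrite nth_cat sn mulnS -addnA ltnNge leq_addr /= addKn IH.
Qed.

(** Used with a head block of size 16 for the first two generators and one block of size 8 for each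
    further generator. *)
Lemma detn_blocks (F : comNzRingType) n r m (f : nat -> nat -> F) :
  (forall t i j, (t < r)%N -> (i < m)%N -> (j < n + m * t)%N -> f (n + m * t + i)%N j = 0) ->
  detn (n + m * r) f =
  detn n f * \prod_(t < r) detn m (fun i j => f (n + m * t + i)%N (n + m * t + j)%N).
Proof.
elim: r => [|r IH] f0; first by rewrite muln0 addn0 big_ord0 mulr1.
rewrite mulnSr addnA detn_upper => [|i j im jn]; last exact: f0.
by rewrite big_ord_recr mulrA /= IH// => t i j tr; apply: f0; apply: leqW.
Qed.

(** * Traces of twisted matrices *)

Section Pairing.
Variable F : comNzRingType.
Implicit Types A B X : 'M[F]_3.

Lemma comm_traceE A B : comm_trace A B =
  \tr (B * A * \adj B * \adj A) - \tr (A * B * \adj A * \adj B).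
Proof. by rewrite /comm_trace !mulrA. Qed.

Lemma tr_twist A B X : \det A = 1 ->
  \tr (twist A B * (A * X)) = \tr (B * X * A) - \tr (B * A * X).
Proof.
move=> dA; have A'A : \adj A * A = 1 by rewrite [_ * A]mul_adj_mx dA.
rewrite /twist dA scale1r mulrBl linearB /= !mulrA -[A * B * _ * A]mulrA A'A mulr1.
by rewrite -(mulrA A B) (tr_mulC A).
Qed.

Lemma tr_twist_adj A B X : \det A = 1 ->
  \tr (twist A B * - (X * \adj A)) = \tr (B * X * \adj A) - \tr (B * \adj A * X).
Proof.
move=> dA; have A'A : \adj A * A = 1 by rewrite [_ * A]mul_adj_mx dA.
rewrite mulrN linearN /= /twist dA scale1r mulrBl linearB /= opprB -!mulrA.
by congr (_ - _); rewrite (tr_mulC A) -!mulrA A'A mulr1.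
Qed.

Lemma pairing_comm A B X : \det A = 1 ->
  pairing A B (A * X) (- (\adj X * \adj A)) =
  (\tr (B * X * A) - \tr (B * A * X)) *
  (\tr (\adj B * \adj X * \adj A) - \tr (\adj B * \adj A * \adj X))
  - (\tr (B * \adj X * \adj A) - \tr (B * \adj A * \adj X)) *
    (\tr (\adj B * X * A) - \tr (\adj B * A * X)).
Proof.
by move=> dA; rewrite /pairing !(tr_twist _ _ dA) !(tr_twist_adj _ _ dA).
Qed.

Lemma tr_conj_sub (X Y D D' : 'M[F]_3) :
  \tr ((D * X * D' - X) * Y) = \tr (X * (D' * Y * D - Y)).
Proof.
rewrite mulrBl mulrBr !linearB /=; congr (_ - _).
by rewrite -!mulrA tr_mulC -!mulrA.
Qed.

(** When [A] has determinant 1, [twist A Y] is Ad_A Y - Y, and Ad of the inverse of [A] is the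
    adjoint of Ad_A for the trace form. *)
Lemma tr_ad_twist A X Y : \det A = 1 ->
  \tr ((\adj A * X * A - X) * Y) = \tr (twist A Y * X).
Proof.
by move=> dA; rewrite tr_conj_sub /twist dA scale1r tr_mulC.
Qed.

(** The first column is 3, 0, 0 because the last two matrices on the left are traceless; the minus
    sign is that of [- \adj B]. *)
Lemma detn3_pairing A B X1 X2 : \det A = 1 ->
  detn 3 (fun i j => \tr (nth 0 [:: 1; \adj A * X1 * A - X1; \adj A * X2 * A - X2] i
                          * nth 0 [:: 1; B; - \adj B] j))
  = - (3 * pairing A B X1 X2).
Proof.
move=> dA; pose Z X := \adj A * X * A - X.
have ZY X Y : \tr (Z X * Y) = \tr (twist A Y * X) by exact: tr_ad_twist.
have Z1 X : \tr (Z X * 1) = 0.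
  by rewrite ZY /twist mulr1 dA scale1r [A * _]mul_mx_adj dA subrr mul0r mxtrace0.
rewrite -/(Z X1) -/(Z X2); move: Z ZY Z1 => Z ZY Z1.
rewrite detn3 /= mul1r !Z1 !mulrN !linearN /= !ZY mxtrace1 /pairing; ring.
Qed.
End Pairing.

(** * Evaluation of the functionals on cocycles *)

Section Assembly.
Variables (R : realType) (k : nat).
Local Notation C := (Cplx R).
Implicit Types (rho : gens R k) (u v : {ffun 'I_k -> 'M[C]_3}) (i g : 'I_k) (w : word k).

Lemma wedge_big I (r : seq I) (f : I -> dform R k) :
  \big[@wedge R k/one_form R k]_(x <- r) f x =
  DForm (\prod_(x <- r) coef (f x)) (flatten [seq factors (f x) | x <- r]).
Proof.
elim: r => [|x r IH]; first by rewrite !big_nil.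
by rewrite !big_cons IH /wedge /=.
Qed.

Definition letter rho (l : 'I_k * bool) : 'M[C]_3 :=
  if l.2 then (rho l.1)^-1 else rho l.1.

Lemma ev_letter rho l : ev rho [:: l] = letter rho l.
Proof. by rewrite /ev big_cons big_nil mulr1. Qed.

Lemma ev_nil rho : ev rho [::] = 1.
Proof. by rewrite /ev big_nil. Qed.

Lemma dev1 rho u l : dev rho u [:: l] = dletter rho u l.
Proof. by rewrite /= ev_nil mulr0 addr0 mulr1. Qed.

Lemma dev2 rho u l l' :
  dev rho u [:: l; l'] = dletter rho u l * letter rho l' + letter rho l * dletter rho u l'.
Proof. by rewrite /= !ev_letter ev_nil mulr0 addr0 mulr1. Qed.

Lemma ev3 rho l l' l'' :
  ev rho [:: l; l'; l''] = letter rho l * letter rho l' * letter rho l''.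
Proof. by rewrite (ev_cons _ l) (ev_cons _ l') !ev_letter mulrA. Qed.

Lemma ev4 rho l1 l2 l3 l4 :
  ev rho [:: l1; l2; l3; l4] = letter rho l1 * letter rho l2 * letter rho l3 * letter rho l4.
Proof. by rewrite (ev_cons _ l1) ev3 ev_letter !mulrA. Qed.

Lemma devD rho u v w : dev rho (u + v) w = dev rho u w + dev rho v w.
Proof.
elim: w => [|l w IH] /=; first by rewrite addr0.
rewrite IH (_ : dletter _ _ _ = dletter rho u l + dletter rho v l).
  by rewrite mulrDl mulrDr addrACA.
rewrite /dletter ffunE; case: ifP => _; first by rewrite mulrDr opprD.
by rewrite mulrDl.
Qed.

Lemma devZ rho x u w : dev rho (x *: u) w = x *: dev rho u w.
Proof.
elim: w => [|l w IH] /=; first by rewrite scaler0.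
rewrite IH (_ : dletter _ _ _ = x *: dletter rho u l).
  by rewrite scalerDr -scalerAl -scalerAr.
rewrite /dletter ffunE; case: ifP => _; last by rewrite -scalerAl.
by rewrite -scalerAr scalerN.
Qed.

Lemma dev_single0 rho i X w : all (fun l => l.1 != i) w -> dev rho (single i X) w = 0.
Proof.
elim: w => //= l w IH /andP[li wi]; rewrite IH// mulr0 addr0 /dletter ffunE (negPf li).
by rewrite mulr0 mul0r oppr0 if_same mul0r.
Qed.

(** Along a coboundary the derivation is inner. Commutators have trace zero, so the differentials of
    trace functions vanish there. *)
Lemma dev_coboundary rho X w : is_SL3_rep rho ->
  dev rho (coboundary rho X) w = ev rho w * X - X * ev rho w.
Proof.
move=> hrho; elim: w => [|l w IH] /=.
  by rewrite /ev big_nil mul1r mulr1 subrr.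
have ul : rho l.1 \is a GRing.unit by exact: SL3_unit.
rewrite IH (_ : dletter _ _ _ = letter rho l * X - X * letter rho l).
  by rewrite (ev_cons _ l w) ev_letter mulrBl mulrBr !mulrA [LHS]addrC subrKA.
rewrite /dletter /letter ffunE; case: ifP => _; last by rewrite mulrBl -!mulrA mulVr// mulr1.
by rewrite mulrBr -!mulrA mulKr// opprB.
Qed.

Lemma tr_dev_coboundary rho X w : is_SL3_rep rho ->
  \tr (dev rho (coboundary rho X) w) = 0.
Proof.
move=> hrho; rewrite dev_coboundary// linearB /= (tr_mulC X).
by rewrite subrr.
Qed.

Lemma tr_coboundary rho X i : is_SL3_rep rho -> \tr (coboundary rho X i) = 0.
Proof.
move=> hrho; rewrite ffunE linearB /= (tr_mulC _ (rho i)^-1).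
by rewrite mulKr ?subrr// SL3_unit.
Qed.

Section Basis.
Variables (c0 : 8.-tuple 'M[C]_3) (hc0 : B_orthonormal_basis c0).

Lemma sl3_tr X : (X \in sl3 R) = (\tr X == 0).
Proof. by rewrite memv_ker lfunE. Qed.

Lemma tr_c0 m : (m < 8)%N -> \tr c0`_m = 0.
Proof.
move=> m8; apply/eqP; rewrite -sl3_tr -(span_basis hc0.1) memv_span// mem_nth//.
by rewrite size_tuple.
Qed.

Lemma basis1_span v : (forall i, \tr (v i) = 0) -> v \in <<basis1 k c0>>%VS.
Proof.
move=> v0; have -> : v = \sum_i \sum_(m < 8) coord c0 m (v i) *: single i c0`_m.
  apply/ffunP => j; rewrite sum_ffunE (bigD1 j)//= [X in _ + X]big1 ?addr0.
    rewrite sum_ffunE [LHS](coord_span (X := c0)).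
      by apply: eq_bigr => m _; rewrite !ffunE eqxx.
    by rewrite (span_basis hc0.1) sl3_tr v0.
  move=> i ij; rewrite sum_ffunE big1// => m _.
  by rewrite !ffunE eq_sym (negPf ij) scaler0.
apply: memv_suml => i _; apply: memv_suml => m _; apply: memvZ; apply: memv_span.
by apply: allpairs_f; rewrite ?mem_enum// mem_nth// size_tuple.
Qed.

Lemma nth_basis1 (g0 : 'I_k) t m : (t < k)%N -> (m < 8)%N ->
  (basis1 k c0)`_(8 * t + m) = single (nth g0 (enum 'I_k) t) c0`_m.
Proof.
move=> tk m8; rewrite (mulnC 8).
have := @nth_allpairs _ _ _ g0 0 0 (@single R k) (enum 'I_k) c0 t m.
by rewrite (size_tuple c0) size_enum_ord; apply.
Qed.

(** The order follows the factors of omega_{1i}, nu_i, nu_{1i}, nu_{2i}. Only [g1], [g2] and [i]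
    occur, which makes the matrix of differentials block triangular. *)
Definition words_at g1 g2 i : seq (word k) :=
  [:: [:: gam g1; bar i]; [:: bar g1; gam i]; [:: gam i]; [:: bar i];
      [:: gam g1; gam i]; [:: bar g1; bar i]; [:: gam g2; gam i]; [:: bar g2; bar i]].

Definition words12 g1 g2 : seq (word k) :=
  [:: [:: gam g1; bar g2]; [:: bar g1; gam g2]; [:: gam g1]; [:: bar g1];
      [:: gam g2]; [:: bar g2]; [:: gam g1; gam g2]; [:: bar g1; bar g2]].

Lemma tr_dletter_single rho i (X Y : 'M[C]_3) l : is_SL3_rep rho ->
  \tr (dletter rho (single i X) l * Y) =
  if l.1 == i then
    if l.2 then \tr (X * - (Y * \adj (rho i))) else \tr (X * (rho i * Y)) else 0.
Proof.
move=> hrho; rewrite /dletter ffunE; case: eqP => [->|_]; last first.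
  by rewrite mulr0 mul0r oppr0 if_same mul0r mxtrace0.
case: ifP => _; last by rewrite -mulrA.
by rewrite mulNr mulrN !linearN /= adj_SL3// -mulrA tr_mulC mulrA.
Qed.

Lemma tr_dev_single1 rho i X l : is_SL3_rep rho ->
  \tr (dev rho (single i X) [:: l]) =
  if l.1 == i then
    \tr (X * (if l.2 then - \adj (rho i) else rho i)) else 0.
Proof.
move=> hrho; rewrite dev1 -[dletter _ _ _]mulr1 tr_dletter_single//.
by rewrite mul1r mulr1; case: l.2.
Qed.

(** The matrices paired with [X] here and in [tr_dev_single1] are those listed in [det9_words],
    signs included. *)
Lemma tr_dev_single2 rho i X l l' : is_SL3_rep rho -> l.1 != i -> l'.1 = i ->
  \tr (dev rho (single i X) [:: l; l']) =
  \tr (X * (let Y := if l.2 then \adj (rho l.1) else rho l.1 in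
            if l'.2 then - (Y * \adj (rho i)) else rho i * Y)).
Proof.
move=> hrho li l'i; rewrite dev2 linearD /= tr_dletter_single// (negPf li) add0r.
by rewrite tr_mulC tr_dletter_single// l'i eqxx /letter adj_SL3//; case: l'.2.
Qed.

Lemma pairing_Delta rho g1 g2 i : is_SL3_rep rho ->
  pairing (rho i) (rho g1) (rho i * rho g2) (- (\adj (rho g2) * \adj (rho i)))
  = Delta g1 g2 i rho.
Proof.
move=> hrho; rewrite pairing_comm; last exact: hrho.
by rewrite /Delta /tau !ev3 /letter /= !adj_SL3.
Qed.

Lemma tau_commE rho l i : is_SL3_rep rho ->
  tau_comm l i rho = comm_trace (rho i) (rho l).
Proof.
by move=> hrho; rewrite comm_traceE /tau_comm /tau !ev4 /letter /= !adj_SL3.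
Qed.

Local Notation vol := (det9 (1 :: tval c0)).

Lemma vol_sqr : vol ^+ 2 = -3.
Proof.
apply: det9_orthonormal => [||i j i8 j8]; rewrite ?size_tuple//; first exact: tr_c0.
have := hc0.2 (Ordinal i8) (Ordinal j8).
by rewrite /calB !(tnth_nth 0).
Qed.

Lemma detn8_vol G :
  detn 8 (fun m a => \tr (c0`_m * nth 0 G a)) = vol^-1 * det9 (1 :: G).
Proof. by apply: detn8_det9; [rewrite size_tuple|exact: tr_c0|exact: vol_sqr]. Qed.

(** Here [det9_words] is used with [A] the image of generator [i] and [B] that of [g1]; the two
    words with [g2] supply [X1] and [X2], whose pairing is [Delta]. *)
Lemma block_det : exists e : bool, forall rho g1 g2 i,
  is_SL3_rep rho -> g1 != i -> g2 != i ->
  detn 8 (fun m a => \tr (dev rho (single i c0`_m) (nth [::] (words_at g1 g2 i) a)))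
  = vol^-1 * ((-1) ^+ e * (tau_comm g1 i rho * Delta g1 g2 i rho)).
Proof.
have [e he] := det9_words C; exists e => rho g1 g2 i hrho g1i g2i.
rewrite tau_commE// -pairing_Delta// -he -detn8_vol; apply: eq_detn => m a m8.
have i1 : (i == i) = true by rewrite eqxx.
case: a => [|[|[|[|[|[|[|[|a]]]]]]]] // _;
 [by rewrite [LHS]tr_dev_single2|by rewrite [LHS]tr_dev_single2|
  by rewrite [LHS]tr_dev_single1// [X in if X then _ else _]i1|
  by rewrite [LHS]tr_dev_single1// [X in if X then _ else _]i1|
  by rewrite [LHS]tr_dev_single2|by rewrite [LHS]tr_dev_single2|
  by rewrite [LHS]tr_dev_single2|by rewrite [LHS]tr_dev_single2].
Qed.

(* Eight auxiliary functionals, completing the differentials to a basis. *)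
Definition phi g1 g2 (X1 X2 : 'M[C]_3) (s : seq 'M[C]_3) c v : C :=
  if (c < 2)%N then \tr (v g2 * nth 0 [:: X1; X2] c) else \tr (v g1 * nth 0 s (c - 2)).

Definition psi rho g1 g2 X1 X2 s (ws : seq (word k)) c v : C :=
  if (c < 8)%N then phi g1 g2 X1 X2 s c v else \tr (dev rho v (nth [::] ws (c - 8))).

(* The columns are [X1, X2] (on [g2]), [s] (on [g1]), then [words12]; they are
   reordered to put those that see only the component [g1] first. *)
Lemma head_det : exists e : bool, forall rho g1 g2 X1 X2 s ws,
  is_SL3_rep rho -> g1 != g2 -> size s = 6%N ->
  detn 16 (fun l c => psi rho g1 g2 X1 X2 s (words12 g1 g2 ++ ws) c
    (single (if (l < 8)%N then g1 else g2) c0`_(if (l < 8)%N then l else l - 8)%N))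
  = (-1) ^+ e * (vol^-1 * det9 ([:: 1; rho g1; - \adj (rho g1)] ++ s)
      * (vol^-1 * (tau_comm g1 g2 rho * pairing (rho g2) (rho g1) X1 X2))).
Proof.
have [e1 h1] := det9_words C.
(* Columns 10 and 11 are the traces of [g1] and its inverse, and 2 to 7 are [s]. The others follow
   in the order of [det9_words], ending with columns 0 and 1 for [X1] and [X2]. *)
have [e2 h2] := @detn_col_reindex C 16
  [:: 10; 11; 2; 3; 4; 5; 6; 7; 8; 9; 12; 13; 14; 15; 0; 1]%N isT.
exists (e2 (+) e1) => rho g1 g2 X1 X2 s ws hrho g12 s6.
rewrite -[LHS](signrMK e2) -h2 signr_addb -mulrA; congr (_ * _).
have g11 : (g1 == g1) = true by rewrite eqxx.
have g22 : (g2 == g2) = true by rewrite eqxx.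
have sE g X : single g X g = X by rewrite ffunE eqxx.
have s0 X : single g2 X g1 = 0 by rewrite ffunE (negPf g12).
have g21 : g1 != g2 by [].
rewrite (@detn_upper _ 8 8); last first.
  move=> i j i8 j8; rewrite ltnNge leq_addr.
  case: j j8 => [|[|j]] j8;
    [by rewrite [psi _ _ _ _ _ _ _ _ _]/psi dev_single0 ?mxtrace0 //= g12|
     by rewrite [psi _ _ _ _ _ _ _ _ _]/psi dev_single0 ?mxtrace0 //= g12|].
  rewrite (_ : nth 0%N _ j.+2 = j.+2); last by case: j j8 => [|[|[|[|[|[|j]]]]]].
  by rewrite /psi j8 /phi /= s0 mul0r mxtrace0.
rewrite mulrCA; congr (_ * _).
  rewrite -[[:: 1; _; _] ++ s]/(1 :: ([:: rho g1; - \adj (rho g1)] ++ s)) -detn8_vol.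
  apply: eq_detn => i j i8 j8; rewrite i8.
  case: j j8 => [|[|j]] j8;
    [by rewrite [LHS]tr_dev_single1// [X in if X then _ else _]g11|
     by rewrite [LHS]tr_dev_single1// [X in if X then _ else _]g11|].
  rewrite (_ : nth 0%N _ j.+2 = j.+2); last by case: j j8 => [|[|[|[|[|[|j]]]]]].
  by rewrite /psi j8 /phi /= sE subn2.
rewrite mulrCA tau_commE// -h1 -detn8_vol.
apply: eq_detn => i j i8 j8; rewrite ltnNge leq_addr addKn.
case: j j8 => [|[|[|[|[|[|[|[|j]]]]]]]] // _;
 [by rewrite [LHS]tr_dev_single2|by rewrite [LHS]tr_dev_single2|
  by rewrite [LHS]tr_dev_single1// [X in if X then _ else _]g22|
  by rewrite [LHS]tr_dev_single1// [X in if X then _ else _]g22|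
  by rewrite [LHS]tr_dev_single2|by rewrite [LHS]tr_dev_single2|
  by rewrite /psi /phi /= sE|by rewrite /psi /phi /= sE].
Qed.

(** Taking adjoints for the trace form moves Ad - 1 from the basis [c0] onto [X1], [X2] and [s].
    Then [det9_ad] handles the action of [rho g1] and [detn3_pairing] that of [rho g2]. *)
Lemma front_det : exists e : bool, forall rho g1 g2 X1 X2 s,
  is_SL3_rep rho -> size s = 6%N ->
  detn 8 (fun m c => phi g1 g2 X1 X2 s c (coboundary rho c0`_m))
  = (-1) ^+ e * (vol^-1 * (det9 ([:: 1; rho g1; - \adj (rho g1)] ++ s)
      * (3 * pairing (rho g2) (rho g1) X1 X2))).
Proof.
have [e he] := det9_ad C; exists (~~ e) => rho g1 g2 X1 X2 s hrho s6.
pose Z X := \adj (rho g2) * X * rho g2 - X.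
have := he (rho g1) 1 (Z X1) (Z X2) s s6.
rewrite (hrho g1) expr1n mul1r (detn3_pairing _ _ _ (hrho g2)) => hdet.
transitivity (vol^-1 * det9 ([:: 1; Z X1; Z X2] ++
    [seq \adj (rho g1) * X * rho g1 - 1 *: X | X <- s])).
  rewrite -[[:: 1; _; _] ++ _]/(1 :: ([:: Z X1; Z X2] ++ _)) -detn8_vol.
  apply: eq_detn => i j i8 j8; rewrite /phi.
  case: j j8 => [|[|j]] j8 /=; rewrite !ffunE !(adj_SL3 (hrho _)) tr_conj_sub //.
  by rewrite subn2 (nth_map 0) ?s6 ?scale1r.
by rewrite hdet signrN; move: (_ ^+ _) (vol^-1) (det9 _) (pairing _ _ _ _) => x y z t; ring.
Qed.
End Basis.
End Assembly.

(** * The trace form as a list of words, and linearity of the functionals *)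

Section VolumeForm.
Variables (R : realType) (k : nat).
Local Notation C := (Cplx R).
Implicit Types (rho : gens R k) (i g : 'I_k) (w : word k).

Definition gens_above : seq 'I_k := [seq i : 'I_k <- index_enum 'I_k | (1 < i)%N].

Lemma val_gens_above : (2 <= k)%N -> map val gens_above = iota 2 (k - 2).
Proof.
move=> k2; rewrite /gens_above -(filter_map val (fun n => 1 < n)%N).
rewrite [index_enum _]/index_enum -enumT val_enum_ord.
rewrite -{1}(subnKC k2) iotaD /=; apply/all_filterP/allP => n.
by rewrite mem_iota => /andP[].
Qed.

Lemma size_gens_above : (2 <= k)%N -> size gens_above = (k - 2)%N.
Proof. by move=> k2; rewrite -(size_map val) val_gens_above// size_iota. Qed.

Lemma nth_gens_above g0 t : (2 <= k)%N -> (t < k - 2)%N ->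
  nth g0 gens_above t = nth g0 (enum 'I_k) (t + 2).
Proof.
move=> k2 tk; apply: val_inj; rewrite /= nth_enum_ord; last by lia.
rewrite -(nth_map _ 0%N val) ?size_gens_above// val_gens_above// nth_iota//.
by rewrite addnC.
Qed.

Lemma trace_volume_formE g1 g2 rho :
  trace_volume_form g1 g2 rho =
  DForm ((tau_comm g1 g2 rho)^-1 * sqrtC (-3) ^+ 3 *
    \prod_(i <- gens_above)
      ((3 * Delta g1 g2 i rho)^-1 * ((tau_comm g1 i rho)^-1 * sqrtC (-3) ^+ 3)))
  [seq differential (tau w)
     | w <- words12 g1 g2 ++ flatten [seq words_at g1 g2 i | i <- gens_above]].
Proof.
rewrite /trace_volume_form -(big_filter _ (fun i : 'I_k => (1 < i)%N)) wedge_big.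
rewrite /wedge /=; congr DForm.
  rewrite !mulr1 exprS expr2 !mulrA; congr (_ * _).
  by apply: eq_bigr => i _; rewrite !mulr1 !mulrA.
by rewrite map_flatten -map_comp; do 8 congr (_ :: _).
Qed.

(** The exchange negates all four differences of traces. *)
Lemma Delta_sym rho g1 i j : Delta g1 i j rho = Delta g1 j i rho.
Proof.
rewrite /Delta; move: (tau _ rho) (tau [:: gam g1; gam j; gam i] rho).
move: (tau [:: bar g1; bar i; bar j] rho) (tau [:: bar g1; bar j; bar i] rho).
move: (tau [:: gam g1; bar i; bar j] rho) (tau [:: gam g1; bar j; bar i] rho).
move: (tau [:: bar g1; gam i; gam j] rho) (tau [:: bar g1; gam j; gam i] rho).
move=> a b c d e f x y; ring.
Qed.

Lemma words12_all g1 g2 (i : 'I_k) n : g1 != i -> g2 != i ->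
  all (fun l => l.1 != i) (nth [::] (words12 g1 g2) n).
Proof.
move=> g1i g2i; case: n => [|[|[|[|[|[|[|[|n]]]]]]]] /=; rewrite ?nth_nil //= ?g1i ?g2i //.
Qed.

Lemma words_at_all g1 g2 j (i : 'I_k) n : g1 != i -> g2 != i -> j != i ->
  all (fun l => l.1 != i) (nth [::] (words_at g1 g2 j) n).
Proof.
move=> g1i g2i ji; case: n => [|[|[|[|[|[|[|[|n]]]]]]]] /=; rewrite ?nth_nil //= ?g1i ?g2i ?ji //.
Qed.

Lemma phiD g1 g2 (X1 X2 : 'M[C]_3) s c u v :
  phi g1 g2 X1 X2 s c (u + v) = phi g1 g2 X1 X2 s c u + phi g1 g2 X1 X2 s c v.
Proof. by rewrite /phi !ffunE; case: ifP => _; rewrite mulrDl mxtraceD. Qed.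

Lemma phiZ g1 g2 (X1 X2 : 'M[C]_3) s c x (u : {ffun 'I_k -> 'M[C]_3}) :
  phi g1 g2 X1 X2 s c (x *: u) = x * phi g1 g2 X1 X2 s c u.
Proof. by rewrite /phi !ffunE; case: ifP => _; rewrite -scalerAl mxtraceZ. Qed.

Lemma psiD rho g1 g2 X1 X2 s ws c u v :
  psi rho g1 g2 X1 X2 s ws c (u + v) =
  psi rho g1 g2 X1 X2 s ws c u + psi rho g1 g2 X1 X2 s ws c v.
Proof. by rewrite /psi; case: ifP => _; rewrite ?phiD// devD mxtraceD. Qed.

Lemma psiZ rho g1 g2 X1 X2 s ws c x u :
  psi rho g1 g2 X1 X2 s ws c (x *: u) = x * psi rho g1 g2 X1 X2 s ws c u.
Proof. by rewrite /psi; case: ifP => _; rewrite ?phiZ// devZ mxtraceZ. Qed.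
End VolumeForm.

(** * Cancellation of the scalar coefficients *)

Section Coefficients.
Variable F : fieldType.
Implicit Types D t q x y z d v sigma : F.

(** As [sigma ^+ 3] is [-3 * sigma], the coefficient of a further generator cancels its block
    determinant up to sign. *)
Lemma block_coef D t x y v sigma : (3 : F) != 0 -> D != 0 -> t != 0 -> sigma != 0 ->
  y * y = 1 -> sigma ^+ 2 = -3 -> v = y * sigma ->
  (3 * D)^-1 * (t^-1 * sigma ^+ 3) * (v^-1 * (x * (t * D))) = - (y * x).
Proof.
move=> n3 D0 t0 s0 y2 s2 ->; rewrite exprS s2.
have y0 : y != 0 by apply: contra_eq_neq y2 => ->; rewrite mul0r eq_sym oner_neq0.
have -> : (y * sigma)^-1 = y * sigma^-1.
  by rewrite invfM; congr (_ * _); apply: (mulfI y0); rewrite y2 mulfV.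
by field; rewrite n3 D0 t0 s0.
Qed.

(** The auxiliary quantities [d] and [q] cancel from the two evaluations; the surviving [3 * v] is,
    up to sign, the cube of [sigma] for the first two generators. *)
Lemma form_coef Om P Q D d t q v sigma y1 y3 y4 z : (3 : F) != 0 ->
  P != 0 -> d != 0 -> t != 0 -> q != 0 -> v != 0 ->
  y1 * y1 = 1 -> y4 * y4 = 1 -> z * z = 1 -> sigma ^+ 2 = -3 -> v = y4 * sigma -> Q * P = z ->
  Om * (y1 * (v^-1 * d * (v^-1 * (t * q))) * P) = y3 * (v^-1 * (d * (3 * q))) * D ->
  Om = - (y1 * y3 * y4 * z) * (t^-1 * sigma ^+ 3 * Q * D).
Proof.
move=> n3 P0 d0 t0 q0 v0 y12 y42 z2 s2 vE QP main; apply: (mulIf P0).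
transitivity (y1 * y3 * 3 * v * t^-1 * D).
  have c0 : v^-1 * d * (v^-1 * (t * q)) != 0 by rewrite !mulf_neq0 ?invr_eq0.
  apply: (mulfI c0).
  transitivity (y1 * (Om * (y1 * (v^-1 * d * (v^-1 * (t * q))) * P))).
    rewrite -[LHS]mul1r -y12; ring.
  by rewrite main; field; rewrite v0 t0.
transitivity (- (y1 * y3 * y4) * (z * (Q * P)) * (t^-1 * sigma ^+ 3 * D)); last by ring.
by rewrite QP z2 exprS s2 vE; ring.
Qed.
End Coefficients.

(** * The volume form *)

Section Main.
Variables (R : realType) (k : nat) (hk : (3 <= k)%N).
Local Notation C := (Cplx R).
Variables (c0 : 8.-tuple 'M[C]_3) (hc0 : B_orthonormal_basis c0).
Variables (g1 g2 : 'I_k) (g1_0 : g1 = 0 :> nat) (g2_1 : g2 = 1 :> nat).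
Implicit Types (rho : gens R k) (i g : 'I_k) (w : word k).

Local Notation vol := (det9 (1 :: tval c0)).
Local Notation L := (gens_above k).
Local Notation ws := (flatten [seq words_at g1 g2 i | i <- L]).

Let k2 : (2 <= k)%N. Proof. exact: ltnW. Qed.

Lemma val_L t : (t < k - 2)%N -> val (nth g1 L t) = t.+2.
Proof.
move=> tk; rewrite -(nth_map _ 0%N val) ?size_gens_above ?k2//.
by rewrite val_gens_above ?k2// nth_iota.
Qed.

Lemma g1_L t : (t < k - 2)%N -> g1 != nth g1 L t.
Proof. by move=> tk; rewrite -val_eqE val_L// /= g1_0. Qed.

Lemma g2_L t : (t < k - 2)%N -> g2 != nth g1 L t.
Proof. by move=> tk; rewrite -val_eqE val_L// /= g2_1. Qed.

Let g12 : g1 != g2.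
Proof. by rewrite -val_eqE /= g1_0 g2_1. Qed.

Lemma enum_g1 : nth g1 (enum 'I_k) 0 = g1.
Proof. by apply: val_inj; rewrite /= nth_enum_ord ?g1_0 // (ltn_trans _ hk). Qed.

Lemma enum_g2 : nth g1 (enum 'I_k) 1 = g2.
Proof. by apply: val_inj; rewrite /= nth_enum_ord ?g2_1 // (ltn_trans _ hk). Qed.

Lemma nth_ws t a : (t < k - 2)%N -> (a < 8)%N ->
  nth [::] ws (8 * t + a) = nth [::] (words_at g1 g2 (nth g1 L t)) a.
Proof.
move=> tk a8; rewrite nth_flatten_const//.
  by rewrite (nth_map g1) ?size_gens_above ?k2.
by rewrite all_map; apply/allP.
Qed.

(** Ordering the basis of cochains by generator gives a block triangular matrix, evaluated by
    [head_det] and [block_det]. *)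
Lemma detn_psi : exists e1 e2 : bool, forall rho X1 X2 s,
  is_SL3_rep rho -> size s = 6%N ->
  detn (k * 8) (fun l c => psi rho g1 g2 X1 X2 s (words12 g1 g2 ++ ws) c (basis1 k c0)`_l)
  = (-1) ^+ e1 * (vol^-1 * det9 ([:: 1; rho g1; - \adj (rho g1)] ++ s)
      * (vol^-1 * (tau_comm g1 g2 rho * pairing (rho g2) (rho g1) X1 X2)))
    * \prod_(i <- L) (vol^-1 * ((-1) ^+ e2 * (tau_comm g1 i rho * Delta g1 g2 i rho))).
Proof.
have [e1 h1] := head_det k hc0; have [e2 h2] := block_det k hc0.
exists e1, e2 => rho X1 X2 s hrho s6.
have kE (f : nat -> nat -> C) : detn (k * 8) f = detn (16 + 8 * (k - 2)) f.
  by congr detn; move: k2; lia.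
rewrite kE.
(* Row block [t] belongs to the generator of ordinal [t + 2]. The columns to its left see only [g1],
   [g2] and generators of smaller ordinal. *)
rewrite detn_blocks => [|t i j tk i8 jt]; last first.
  have -> : (basis1 k c0)`_(16 + 8 * t + i) = single (nth g1 L t) c0`_i.
    have -> : (16 + 8 * t + i = 8 * (t + 2) + i)%N by lia.
    rewrite (nth_basis1 _ g1) ?nth_gens_above ?k2//; lia.
  rewrite /psi; case: ltnP => j8.
    rewrite /phi !ffunE (negPf (g1_L tk)) (negPf (g2_L tk)) !mul0r mxtrace0 if_same//.
  rewrite dev_single0 ?mxtrace0// nth_cat; case: ltnP => j16.
    by apply: words12_all; [exact: g1_L|exact: g2_L].
  rewrite /= in j16 *.
  have -> : (j - 8 - 8 = 8 * ((j - 16) %/ 8) + (j - 16) %% 8)%N by lia.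
  have jk : ((j - 16) %/ 8 < k - 2)%N by lia.
  rewrite nth_ws ?ltn_mod//.
  apply: words_at_all; [exact: g1_L|exact: g2_L|].
  by rewrite -val_eqE !val_L// eqSS eqSS neq_ltn; apply/orP; left; lia.
congr (_ * _).
  rewrite -(h1 rho g1 g2 X1 X2 s ws hrho g12 s6); apply: eq_detn => l c l16 c16; congr psi.
  case: ltnP => l8.
    have -> : l = (8 * 0 + l)%N by [].
    by rewrite (nth_basis1 _ g1) ?enum_g1 // (ltn_trans _ hk).
  have -> : ((basis1 k c0)`_l = (basis1 k c0)`_(8 * 1 + (l - 8))) by congr nth; lia.
  rewrite (nth_basis1 _ g1) ?enum_g2 // ?(ltn_trans _ hk)//; lia.
rewrite (big_nth g1) size_gens_above ?k2// big_mkord; apply: eq_bigr => t _.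
rewrite -h2 //; try exact: g1_L; try exact: g2_L.
apply: eq_detn => m a m8 a8.
have -> : (basis1 k c0)`_(16 + 8 * t + m) = single (nth g1 L t) c0`_m.
  have -> : (16 + 8 * t + m = 8 * (t + 2) + m)%N by lia.
  by rewrite (nth_basis1 _ g1) ?nth_gens_above ?k2//; move: (ltn_ord t); lia.
rewrite /psi (_ : (16 + 8 * t + a < 8)%N = false); last by lia.
have -> : (16 + 8 * t + a - 8 = 8 + (8 * t + a))%N by lia.
by rewrite nth_cat /= addKn nth_ws.
Qed.

(** The differentials kill the coboundary rows, which leaves [front_det] and the determinant of the
    differentials on the tangent vectors. *)
Lemma detn_psi_tangent : exists e : bool, forall rho X1 X2 s (p : 'I_(8 * k - 8) -> curve R k),
  is_SL3_rep rho -> size s = 6%N -> (forall j, curve_at rho (p j)) ->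
  detn (k * 8) (fun r c => psi rho g1 g2 X1 X2 s (words12 g1 g2 ++ ws) c
    ([seq coboundary rho X | X <- c0] ++ [seq velocity rho (p j) | j <- enum 'I_(8 * k - 8)])`_r)
  = (-1) ^+ e * (vol^-1 * (det9 ([:: 1; rho g1; - \adj (rho g1)] ++ s)
      * (3 * pairing (rho g2) (rho g1) X1 X2)))
    * \det (\matrix_(i < 8 * k - 8, j < 8 * k - 8)
        (nth (fun=> 0) [seq differential (tau w) | w <- words12 g1 g2 ++ ws] i) (p j)).
Proof.
have [e he] := front_det k hc0; exists e => rho X1 X2 s p hrho s6 hp.
have kE : (k * 8 = 8 + (8 * k - 8))%N by move: k2; lia.
rewrite [in LHS]kE detn_lower => [|i j i8 j8]; last first.
  rewrite nth_cat size_map size_tuple i8 (nth_map 0) ?size_tuple//.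
  by rewrite /psi ltnNge leq_addr /= tr_dev_coboundary.
congr (_ * _).
  rewrite -(he rho g1 g2 X1 X2 s hrho s6); apply: eq_detn => m c m8 c8.
  by rewrite nth_cat size_map size_tuple m8 (nth_map 0) ?size_tuple// /psi c8.
have size_ws : size (words12 g1 g2 ++ ws) = (8 * k - 8)%N.
  rewrite size_cat size_flatten /shape -map_comp (eq_map (g := fun=> 8%N))//.
  rewrite sumnE big_map big_const_seq count_predT size_gens_above ?k2// iter_addn.
  by rewrite [size _]/=; move: k2; lia.
(* Vectors index the rows here, but the columns in [eval_form]. *)
rewrite /detn -det_tr; congr (\det _); apply/matrixP => i j; rewrite !mxE.
rewrite (nth_map [::]) ?size_ws// (differential_tau _ hrho (hp j)).
rewrite nth_cat size_map size_tuple ltnNge leq_addr addKn.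
by rewrite (nth_map j) ?size_enum_ord// nth_ord_enum /psi ltnNge leq_addr addKn.
Qed.

Lemma volume_form : exists eps : bool,
  forall rho, good_rep rho -> ~ crit g1 g2 rho ->
  forall p : 'I_(8 * k - 8) -> curve R k, (forall j, curve_at rho (p j)) ->
    Omega c0 rho [seq velocity rho (p j) | j <- enum 'I_(8 * k - 8)]
    = (-1) ^+ eps * eval_form (trace_volume_form g1 g2 rho) p.
Proof.
have [e1 [e2 hN]] := detn_psi; have [e3 hP] := detn_psi_tangent.
have sg (b : bool) : ((-1) ^+ b * (-1) ^+ b = 1 :> C)%R by rewrite -signr_addb addbb.
set sigma : C := sqrtC (-3).
have sigma2 : sigma ^+ 2 = -3 by rewrite sqrtCK.
have vol2 := vol_sqr hc0.
(* The choice of [c0] fixes which of the two square roots of -3 [vol] is. *)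
have [e4 volE] : exists e4 : bool, vol = (-1) ^+ e4 * sigma.
  have /eqP : vol ^+ 2 = sigma ^+ 2 by rewrite vol2 sigma2.
  rewrite eqf_sqr => /orP[] /eqP ->; first by exists false; rewrite mul1r.
  by exists true; rewrite mulN1r.
have n3 : (3 : C) != 0 by rewrite pnatr_eq0.
have sigma_neq0 : sigma != 0.
  by apply: contra_eq_neq sigma2 => ->; rewrite expr2 mul0r eq_sym oppr_eq0.
have vol_neq0 : vol != 0 by rewrite volE mulf_neq0// signr_eq0.
(* By [block_coef] each of the [k - 2] further generators contributes the sign
   [(-1) ^+ (~~ (e4 (+) e2))]; [kappa] is the parity of their product. *)
pose kappa : bool := odd ((~~ (e4 (+) e2)) * (k - 2)).
exists (~~ (e1 (+) e3 (+) e4 (+) kappa)) => rho [hrho _ _] hcrit p hp.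
have tau_neq0 i : (0 < i)%N -> tau_comm g1 i rho != 0.
  by move=> i0; apply/eqP => /subr0_eq h; apply: hcrit; left; exists i.
have Delta_neq0 i : (1 < i)%N -> Delta g1 g2 i rho != 0.
  by move=> i1; apply/eqP => h; apply: hcrit; right; exists i.
(* A third generator provides auxiliary matrices whose pairing is a [Delta], hence nonzero outside
   [crit]. *)
pose g3 : 'I_k := Ordinal hk.
pose X1 := rho g2 * rho g3; pose X2 := - (\adj (rho g3) * \adj (rho g2)).
have qE : pairing (rho g2) (rho g1) X1 X2 = Delta g1 g2 g3 rho.
  by rewrite pairing_Delta// Delta_sym.
have tau12 : tau_comm g1 g2 rho != 0 by apply: tau_neq0; rewrite g2_1.
have [s [s6 d9]] : exists s, size s = 6%N /\
    det9 ([:: 1; rho g1; - \adj (rho g1)] ++ s) != 0.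
  by apply: (@det9_extension _ (rho g2)); rewrite -?tau_commE.
have := basis_det_mul (a := [seq coboundary rho X | X <- c0] ++
    [seq velocity rho (p j) | j <- enum 'I_(8 * k - 8)]) (b := basis1 k c0)
  (psiD rho g1 g2 X1 X2 s (words12 g1 g2 ++ ws)) (psiZ rho g1 g2 X1 X2 s (words12 g1 g2 ++ ws)).
rewrite -/(Omega c0 rho _) hN// hP// qE trace_volume_formE /eval_form /=.
move=> /(_ _)/wrap[|main].
  move=> i i8; apply: (basis1_span hc0) => g; rewrite nth_cat size_map size_tuple.
  case: ltnP => i8'; first by rewrite (nth_map 0) ?size_tuple// tr_coboundary.
  have ik : (i - 8 < 8 * k - 8)%N by move: i8; clear -i8'; lia.
  by rewrite (nth_map (Ordinal ik)) ?size_enum_ord// tr_velocity.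
rewrite -/sigma.
set Q := \prod_(i <- _) ((3 * _)^-1 * _).
set P := \prod_(i <- _) (vol^-1 * _) in main.
have P_neq0 : P != 0.
  rewrite prodf_seq_neq0; apply/allP => i; rewrite mem_filter => /andP[i1 _] /=.
  have td0 := mulf_neq0 (tau_neq0 i (ltnW i1)) (Delta_neq0 i i1).
  by rewrite (mulf_neq0 (invr_neq0 vol_neq0) (mulf_neq0 (negbT (signr_eq0 _ _)) td0)).
have QP : Q * P = (-1) ^+ kappa.
  rewrite /Q /P -big_split /=.
  rewrite (eq_big_seq (fun=> (-1) ^+ (~~ (e4 (+) e2)))) => [|i]; last first.
    rewrite mem_filter => /andP[i1 _].
    rewrite signrN signr_addb.
    exact: block_coef n3 (Delta_neq0 i i1) (tau_neq0 i (ltnW i1)) sigma_neq0 (sg e4)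
      sigma2 volE.
  by rewrite big_const_seq count_predT size_gens_above ?k2// iter_mulr_1 -exprM signr_odd.
rewrite signrN !signr_addb.
exact: form_coef n3 P_neq0 d9 tau12 (Delta_neq0 g3 isT) vol_neq0 (sg e1) (sg e4)
  (sg kappa) sigma2 volE QP main.
Qed.

End Main.

Theorem theorem7 (R : realType) (k : nat) (hk : (3 <= k)%N)
    (g1 := Ordinal (ltnW (ltnW hk)) : 'I_k) (g2 := Ordinal (ltnW hk) : 'I_k)
    (c0 : 8.-tuple 'M[Cplx R]_3) (hc0 : B_orthonormal_basis c0) :
  exists eps : bool,
    forall (rho : gens R k), good_rep rho -> ~ crit g1 g2 rho ->
    forall p : 'I_(8 * k - 8) -> curve R k, (forall j, curve_at rho (p j)) ->
      Omega c0 rho [seq velocity rho (p j) | j <- enum 'I_(8 * k - 8)]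
      = (-1) ^+ eps * eval_form (trace_volume_form g1 g2 rho) p.
Proof. exact: volume_form. Qed.
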